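(* Suppose $q$ is odd. Let $K$ be an imaginary quadratic extension of $k$ and let $z=(-b+\sqrt{d})/2a\in\mathscr{D}_K$, where $az^2+bz+c=0$ is the defining equation with $a,b,c\in A$, $a$ monic, $|b|<|a|\le|c|$, $\gcd(a,b,c)=1$, and $d=b^2-4ac$. Then: (1) if $|z|=1$ then $|j(z)|\le1/q$; (2) if $|z|>1$ then $|j(z)|=B_q^{|z|}$, where $B_q=q^q$ if $\deg(d)$ is even and $B_q=q^{\sqrt{q}(q+1)/2}$ if $\deg(d)$ is odd.
   Context: $A=\mathbb{F}_q[T]$, $k=\mathbb{F}_q(T)$, $k_\infty=\mathbb{F}_q((1/T))$, $\mathbf{C}$ the completion of an algebraic closure of $k_\infty$ with absolute value $|\cdot|$ normalized so that $|a|=q^{\deg a}$ for $0\ne a\in A$; $\Omega=\mathbf{C}\setminus k_\infty$. $K/k$ is imaginary quadratic if $[K:k]=2$ and $\infty$ does not split in $K$; $K\subset\mathbf{C}$. The quadratic fundamental domain $\mathscr{D}$ is the set of $z\in\Omega$ satisfying an equation $az^2+bz+c=0$ with $a,b,c\in A$, $a$ monic, $|b|<|a|\le|c|$, $\gcd(a,b,c)=1$, and $\mathscr{D}_K=\mathscr{D}\cap K$. For $z\in\Omega$, $j(z)$ is the $j$-invariant of the rank-2 Drinfeld module $\phi$ attached to the lattice $Az+A$: writing $\phi_T=T+g\tau+\Delta\tau^2$, $j=g^{q+1}/\Delta$. *)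

(* Defs.v *)
From HB Require Import structures.
From mathcomp Require Import all_boot all_order all_algebra all_field finmap.
From mathcomp Require Import all_classical all_reals all_analysis.
From mathcomp Require Import showcase.summability.

Set Implicit Arguments.
Unset Strict Implicit.
Unset Printing Implicit Defensive.

Import Order.TTheory GRing.Theory Num.Theory.
Import numFieldNormedType.Exports.

Local Open Scope classical_set_scope.
Local Open Scope ring_scope.

Notation "p %:F" := (tofrac p) : ring_scope.

Notation ratfun F := {fraction {poly F}}.

(* deg 0 = 0 by convention. *)
Definition deg (F : fieldType) (p : {poly F}) : nat := (size p).-1.

Record absolute_value (R : realType) (L : fieldType) (v : L -> R) : Prop := {
  absv_ge0 : forall x, 0 <= v x;
  absv_eq0 : forall x, v x = 0 <-> x = 0;
  absvM : forall x y, v (x * y) = v x * v y;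
  absvD : forall x y, v (x + y) <= Num.max (v x) (v y)
}.

(* By multiplicativity, this says that v restricts on k to the absolute value
   of the place oo, normalized by |a| = q ^ deg a. *)
Definition extends_infty (F : finFieldType) (R : realType) (L : fieldType)
    (iota : ratfun F -> L) (v : L -> R) : Prop :=
  forall p : {poly F}, p != 0 -> v (iota p%:F) = #|F|%:R ^+ deg p.

Section Completion.
Variables (F : finFieldType) (R : realType) (C : fieldType).
Variables (iota : {rmorphism ratfun F -> C}) (abs : C -> R).

Definition cvg_abs (u : nat -> C) (l : C) : Prop :=
  (fun n => abs (u n - l)) @ \oo --> (0 : R).

Definition cauchy_abs (u : nat -> C) : Prop :=
  forall e : R, 0 < e ->
    exists N, forall m n, (N <= m)%N -> (N <= n)%N -> abs (u m - u n) < e.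

Local Notation T := (iota 'X%:F).

(* F_q((1/T)) inside C: sums of the Laurent series
   T^N * \sum_i (u i) * T^(-i) with u i in F_q. *)
Definition kinfty : set C :=
  [set x | exists (N : nat) (u : nat -> F),
    cvg_abs (fun n => T ^+ N * \sum_(i < n) iota (u i)%:P%:F * T ^- i) x].

Definition kinfty_bar : set C :=
  [set x | exists p : {poly C},
    [/\ p != 0, forall i, kinfty p`_i & root p x]].

(* C, together with abs, is the completion of an algebraic closure of
   F_q((1/T)), the latter being realized as kinfty_bar. *)
Record is_Cinfty : Prop := {
  Cinfty_absv : absolute_value abs;
  Cinfty_normalized : extends_infty iota abs;
  Cinfty_complete : forall u, cauchy_abs u -> exists l, cvg_abs u l;
  Cinfty_closed : forall p : {poly C}, (forall i, kinfty_bar p`_i) ->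
    (1 < size p)%N -> exists2 x, kinfty_bar x & root p x;
  Cinfty_dense : forall (x : C) (e : R), 0 < e ->
    exists2 y, kinfty_bar y & abs (x - y) < e
}.

Definition Omega : set C := ~` kinfty.

Definition defining_equation (a b c : {poly F}) (z : C) : Prop :=
  [/\ iota a%:F * z ^+ 2 + iota b%:F * z + iota c%:F = 0,
      a \is monic,
      abs (iota b%:F) < abs (iota a%:F),
      abs (iota a%:F) <= abs (iota c%:F)
    & gcdp (gcdp a b) c %= 1].

Definition quad_fund_domain : set C :=
  [set z | Omega z /\ exists a b c, defining_equation a b c z].

Definition lattice (z : C) : set C :=
  [set w | exists a b : {poly F}, w = iota a%:F * z + iota b%:F].

(* e_L(x) = x * \prod_(l in L, l != 0) (1 - x / l), the product being the limit
   of the net of products over finite subsets. *)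
Definition lattice_exp (L : set C) (x : C) : C :=
  xget 0 [set y | (fun S : {fset C} =>
    abs (x * \prod_(l <- S | (l \in L) && (l != 0)) (1 - x / l) - y))
      @ totally --> (0 : R)].

(* Elements of the twisted polynomial ring C{tau}, with tau c = c^q tau, are
   represented by their coefficient sequences, i.e., 'X stands for tau. *)
Definition twisted_mul (s t : {poly C}) : {poly C} :=
  \sum_(i < size s) \sum_(j < size t) (s`_i * t`_j ^+ (#|F| ^ i)) *: 'X^(i + j).

Definition twisted_eval (s : {poly C}) (x : C) : C :=
  \sum_(i < size s) s`_i * x ^+ (#|F| ^ i).

Record drinfeld_module (r : nat) (phi : {poly F} -> {poly C}) : Prop := {
  drinfeldD : forall a b, phi (a + b) = phi a + phi b;
  drinfeldM : forall a b, phi (a * b) = twisted_mul (phi a) (phi b);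
  drinfeldC : forall c : F, phi c%:P = (iota c%:P%:F)%:P;
  drinfeld_coef0 : forall a, (phi a)`_0 = iota a%:F;
  drinfeld_rank : forall a, a != 0 -> size (phi a) = (r * deg a).+1
}.

Definition attached (L : set C) (phi : {poly F} -> {poly C}) : Prop :=
  forall (a : {poly F}) (x : C),
    lattice_exp L (iota a%:F * x) = twisted_eval (phi a) (lattice_exp L x).

Definition drinfeld_j (phi : {poly F} -> {poly C}) : C :=
  let g := (phi 'X)`_1 in let Delta := (phi 'X)`_2 in
  g ^+ #|F|.+1 / Delta.

(* For z in Omega there is exactly one phi as below; elsewhere the value is
   irrelevant. *)
Definition j_invariant (z : C) : C :=
  xget 0 [set j | exists phi,
    [/\ drinfeld_module 2 phi, attached (lattice z) phi & j = drinfeld_j phi]].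

End Completion.

(* Places of K above oo correspond to absolute values of K extending the
   normalized one of k; "oo does not split" means that there is only one. *)
Definition infty_nonsplit (F : finFieldType) (R : realType)
    (K : fieldExtType (ratfun F)) : Prop :=
  forall v w : K -> R,
    absolute_value v -> extends_infty (in_alg K) v ->
    absolute_value w -> extends_infty (in_alg K) w ->
    v =1 w.

Definition imaginary_quadratic (F : finFieldType) (R : realType)
    (K : fieldExtType (ratfun F)) : Prop :=
  \dim {: K} = 2%N /\ infty_nonsplit R K.

Definition Bconst (R : realType) (q n : nat) : R :=
  if odd n then q%:R `^ (Num.sqrt q%:R * (q%:R + 1) / 2) else q%:R ^+ q.

(* Main.v *)
(* Write e for the exponential of the lattice L = A z + A and q for #|F|.  The
   lattice T^-1 L contains L with quotient spanned over F by z/T and 1/T, so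
   adjoining these two vectors one after the other gives
     e(T x) = T psi_2 (psi_1 (e x)),   psi_i y = y - y^q / v_i^(q-1),
   with v_1 = e(1/T) and v_2 = psi_1 (e(z/T)).  This exhibits phi_T and yields
     j(z) = T^q (w^(q-1) + 1)^(q+1) / w^(q(q-1)),
     w = y - y^q,   y = e(z/T) / e(1/T).
   Since z is not in F_q((1/T)), no cancellation occurs in |u z + v|, so that
   |u z + v| = max(|u| |z|, |v|) on L.
   If |z| = 1, then y is within 1/q of z and z^(q^2) within 1/q of z, because
   z^2 is within 1/q of a constant; hence w^q is within 1/q of -w, and
   |w^(q-1) + 1| <= 1/q.
   If |z| > 1, then |y| > 1 and |j(z)| = q^q |y|^(q(q-1)).  The functional
   equation gives t_k = q t_(k+1)^q for t_k = q |e(z/T^k)| as long as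
   t_(k+1) > 1, and t_k = q |z/T^k| for the first k with |z/T^k| <= 1; now
   |y| = t_1. *)
Require Import Defs.
From HB Require Import structures.
From mathcomp Require Import all_boot all_order all_algebra all_field finmap.
From mathcomp Require Import all_classical all_reals all_analysis.
From mathcomp Require Import ring zify.
From mathcomp Require Import showcase.summability.
Set Implicit Arguments.
Unset Strict Implicit.
Unset Printing Implicit Defensive.
Import Order.TTheory GRing.Theory Num.Theory.
Import numFieldNormedType.Exports.
Local Open Scope classical_set_scope.
Local Open Scope ring_scope.

(** * Non-archimedean absolute values *)

(** Cancellation in u z + v would give z a leading term e T^N. The quadratic has small trace, so z
    would lie at distance |2 e T^N| = |z| from its conjugate (q is odd), and a Newton iteration
    would produce all further digits, contradicting [Omega]. The infinite product is never
    manipulated directly. The u z + v with deg u, deg v < n form a finite F-space V_n, whose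
    F-linear product polynomial is computed by adjoining basis vectors. As V_(n+1) = T (V_n + F/T +
    F z/T) exactly, the functional equation is an identity at each finite level and passes to the
    limit. Lattice vectors outside V_n have size at least q^n, so |e x| is attained at a finite
    level. As [j_invariant] picks its value by [xget], two facts are needed: all attached modules
    share one phi_T, since twisted polynomials are determined by infinitely many values, and one
    such module exists, generated by that phi_T. The two forms of B_q come from the end of the
    recursion: the last t is q or sqrt q, according to the parity of deg c - deg a, which is that of
    deg d. *)

Section AbsoluteValue.
Variables (R : realType) (L : fieldType) (v : L -> R).
Hypothesis hv : absolute_value v.

Lemma absv0 : v 0 = 0.
Proof. exact/(absv_eq0 hv). Qed.

Lemma absv_gt0 x : (0 < v x) = (x != 0).
Proof.
rewrite lt_def (absv_ge0 hv) andbT; congr (~~ _).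
by apply/eqP/eqP => /(absv_eq0 hv).
Qed.

Lemma absv_neq0 x : (v x == 0) = (x == 0).
Proof. by apply/eqP/eqP => /(absv_eq0 hv). Qed.

Lemma absv1 : v 1 = 1.
Proof.
have h : v 1 != 0 by rewrite absv_neq0 oner_neq0.
by apply: (mulfI h); rewrite -(absvM hv) !mulr1.
Qed.

Lemma absvX x n : v (x ^+ n) = v x ^+ n.
Proof.
by elim: n => [|n ih]; rewrite ?expr0 ?absv1 // !exprS (absvM hv) ih.
Qed.

Lemma absvN x : v (- x) = v x.
Proof.
have h : v (-1) = 1.
  apply/eqP; rewrite -(@pexpr_eq1 _ _ 2) ?(absv_ge0 hv) //.
  by rewrite -absvX sqrrN expr1n absv1.
by rewrite -mulN1r (absvM hv) h mul1r.
Qed.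

Lemma absvV x : v x^-1 = (v x)^-1.
Proof.
have [->|x0] := eqVneq x 0; first by rewrite invr0 absv0 invr0.
have h : v x != 0 by rewrite absv_neq0.
by apply: (mulfI h); rewrite -(absvM hv) !divff ?absv1.
Qed.

Lemma absvBC x y : v (x - y) = v (y - x).
Proof. by rewrite -absvN opprB. Qed.

Lemma absvD_le x y e : v x <= e -> v y <= e -> v (x + y) <= e.
Proof.
by move=> hx hy; apply: le_trans (absvD hv x y) _; rewrite ge_max hx hy.
Qed.

Lemma absvB_le x y e : v x <= e -> v y <= e -> v (x - y) <= e.
Proof. by move=> hx hy; apply: absvD_le; rewrite ?absvN. Qed.

Lemma absvD_lt x y e : v x < e -> v y < e -> v (x + y) < e.
Proof.
by move=> hx hy; apply: le_lt_trans (absvD hv x y) _; rewrite gt_max hx hy.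
Qed.

Lemma absvB_lt x y e : v x < e -> v y < e -> v (x - y) < e.
Proof. by move=> hx hy; apply: absvD_lt; rewrite ?absvN. Qed.

Lemma absvD_eq x y : v y < v x -> v (x + y) = v x.
Proof.
move=> h; apply/le_anti/andP; split.
  by apply: absvD_le => //; exact: ltW.
have : v x <= Num.max (v (x + y)) (v y).
  by rewrite -(absvN y) -{1}(addrK y x); exact: (absvD hv).
by rewrite le_max => /orP[//|]; rewrite leNgt h.
Qed.

Lemma absvB_eq x y : v y < v x -> v (x - y) = v x.
Proof. by move=> h; rewrite absvD_eq // absvN. Qed.

Lemma absv_near x y : v (x - y) < v y -> v x = v y.
Proof. by move=> h; rewrite -{1}(subrK y x) addrC absvD_eq. Qed.

Lemma absv_prod (I : Type) (s : seq I) (P : pred I) (f : I -> L) :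
  v (\prod_(i <- s | P i) f i) = \prod_(i <- s | P i) v (f i).
Proof. exact: (big_morph v (absvM hv) absv1). Qed.

(** Multiplying p by 1 - t changes it by t p, and |p| <= 1 persists. The bound does not depend on
    the number of factors, which makes it fit for tails of lattice products. *)
Lemma absv_prod1 (I : eqType) (s : seq I) (P : pred I) (t : I -> L) e :
    0 <= e <= 1 -> (forall i, i \in s -> P i -> v (t i) <= e) ->
  v (\prod_(i <- s | P i) (1 - t i) - 1) <= e.
Proof.
move=> /andP[e0 e1]; elim: s => [|i s ih] h.
  by rewrite big_nil subrr absv0.
have {}ih := ih (fun j hj => h j (mem_behead (s := i :: s) hj)).
rewrite big_cons; case: ifP => [Pi|_//].
set p := \prod_(_ <- s | _) _ in ih *.
have -> : (1 - t i) * p - 1 = (p - 1) - t i * p by ring.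
have hi := h i (mem_head _ _) Pi.
apply: absvB_le => //; rewrite (absvM hv).
suff hp : v p <= 1 by rewrite -[e]mulr1 ler_pM ?(absv_ge0 hv).
rewrite -(subrK 1 p); apply: absvD_le; last by rewrite absv1.
exact: le_trans ih e1.
Qed.

Lemma absv_exprB x y n eps : v x <= 1 -> v y <= 1 -> v (x - y) <= eps ->
  v (x ^+ n - y ^+ n) <= eps.
Proof.
move=> x1 y1 xy; have eps0 : 0 <= eps := le_trans (absv_ge0 hv _) xy.
elim: n => [|n ih]; first by rewrite subrr absv0.
have -> : x ^+ n.+1 - y ^+ n.+1 = x * (x ^+ n - y ^+ n) + (x - y) * y ^+ n.
  by rewrite !exprS; ring.
apply: absvD_le; rewrite (absvM hv).
  by rewrite -[eps]mul1r ler_pM ?(absv_ge0 hv).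
by rewrite -[eps]mulr1 ler_pM ?(absv_ge0 hv) // absvX exprn_ile1 ?(absv_ge0 hv).
Qed.

(** * Limits of sequences for a non-archimedean absolute value *)

Lemma cvg_absP (u : nat -> L) l : cvg_abs v u l <->
  (forall e : R, 0 < e ->
     exists N, forall n, (N <= n)%N -> v (u n - l) < e).
Proof.
split=> [/cvgrPdist_lt h e e0|h].
  have [N _ hN] := h e e0; exists N => n Nn.
  by have := hN n Nn; rewrite /= sub0r normrN ger0_norm ?(absv_ge0 hv).
apply/cvgrPdist_lt => e e0; have [N hN] := h e e0; exists N => // n /= Nn.
by rewrite sub0r normrN ger0_norm ?(absv_ge0 hv) // hN.
Qed.

Lemma cvg_abs_cst l : cvg_abs v (fun=> l) l.
Proof. by apply/cvg_absP => e e0; exists 0%N => n _; rewrite subrr absv0. Qed.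

Lemma cvg_abs_shift u l : cvg_abs v u l -> cvg_abs v (fun n => u n.+1) l.
Proof.
move=> /cvg_absP h; apply/cvg_absP => e e0; have [N hN] := h e e0.
by exists N => n Nn; apply: hN; exact: leqW.
Qed.

Lemma cvg_absD u w l m : cvg_abs v u l -> cvg_abs v w m ->
  cvg_abs v (fun n => u n + w n) (l + m).
Proof.
move=> /cvg_absP hu /cvg_absP hw; apply/cvg_absP => e e0.
have [N hN] := hu e e0; have [M hM] := hw e e0.
exists (maxn N M) => n; rewrite geq_max => /andP[Nn Mn].
by rewrite opprD addrACA; apply: absvD_lt; [exact: hN|exact: hM].
Qed.

Lemma cvg_absN u l : cvg_abs v u l -> cvg_abs v (fun n => - u n) (- l).
Proof.
move=> /cvg_absP hu; apply/cvg_absP => e e0; have [N hN] := hu e e0.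
by exists N => n Nn; rewrite -opprD absvN hN.
Qed.

Lemma cvg_absB u w l m : cvg_abs v u l -> cvg_abs v w m ->
  cvg_abs v (fun n => u n - w n) (l - m).
Proof. by move=> hu hw; apply: cvg_absD => //; exact: cvg_absN. Qed.

Lemma cvg_absM u w l m : cvg_abs v u l -> cvg_abs v w m ->
  cvg_abs v (fun n => u n * w n) (l * m).
Proof.
move=> /cvg_absP hu /cvg_absP hw; apply/cvg_absP => e e0.
have [N1 hN1] := hu 1 ltr01.
pose B := Num.max 1 (Num.max (v l) (v m)).
have B0 : 0 < B by rewrite lt_max ltr01.
have hl : v l <= B by rewrite !le_max lexx orbT.
have hm : v m <= B by rewrite !le_max lexx !orbT.
have eB : 0 < e / B by rewrite divr_gt0.
have [N hN] := hu _ eB; have [M hM] := hw _ eB.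
exists (maxn N1 (maxn N M)) => n; rewrite !geq_max => /and3P[n1 Nn Mn].
have hun : v (u n) <= B.
  rewrite -(subrK l (u n)); apply: absvD_le => //.
  by apply: ltW; apply: (lt_le_trans (hN1 n n1)); rewrite le_max lexx.
have -> : u n * w n - l * m = u n * (w n - m) + (u n - l) * m by ring.
apply: absvD_lt; rewrite (absvM hv).
  apply: (@le_lt_trans _ _ (B * v (w n - m))).
    by rewrite ler_wpM2r ?(absv_ge0 hv).
  by rewrite mulrC -ltr_pdivlMr // hM.
apply: (@le_lt_trans _ _ (v (u n - l) * B)).
  by rewrite ler_wpM2l ?(absv_ge0 hv).
by rewrite -ltr_pdivlMr // hN.
Qed.

Lemma cvg_absX u l k : cvg_abs v u l -> cvg_abs v (fun n => u n ^+ k) (l ^+ k).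
Proof.
move=> h; elim: k => [|k ih]; first exact: cvg_abs_cst.
rewrite exprS; under eq_fun do rewrite exprS.
exact: cvg_absM.
Qed.

Lemma cvg_abs_unique u l m : cvg_abs v u l -> cvg_abs v u m -> l = m.
Proof.
move=> /cvg_absP hu /cvg_absP hw; apply/eqP; rewrite -subr_eq0; apply/negP.
rewrite -absv_neq0 => /negP h.
have e0 : 0 < v (l - m) by rewrite lt_def h (absv_ge0 hv).
have [N hN] := hu _ e0; have [M hM] := hw _ e0.
have := absvB_lt (hM _ (leq_maxr N M)) (hN _ (leq_maxl N M)).
by rewrite opprB addrC addrA subrK ltxx.
Qed.

(** Once |u n - l| < |l|, the ultrametric inequality forces equality of absolute values, not mere
    closeness. *)
Lemma cvg_abs_near u l : cvg_abs v u l -> l != 0 ->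
  exists N, forall n, (N <= n)%N -> v (u n) = v l.
Proof.
move=> /cvg_absP hu; rewrite -absv_gt0 => l0; have [N hN] := hu _ l0.
by exists N => n Nn; apply: absv_near; exact: hN.
Qed.

Lemma cvg_absV u l : cvg_abs v u l -> l != 0 ->
  cvg_abs v (fun n => (u n)^-1) l^-1.
Proof.
move=> hu l0; have [N hN] := cvg_abs_near hu l0.
have vl : 0 < v l by rewrite absv_gt0.
move/cvg_absP: hu => hu; apply/cvg_absP => e e0.
have [M hM] := hu (e * v l ^+ 2) (mulr_gt0 e0 (exprn_gt0 _ vl)).
exists (maxn N M) => n; rewrite geq_max => /andP[Nn Mn].
have u0 : u n != 0 by rewrite -absv_gt0 hN.
have -> : (u n)^-1 - l^-1 = - ((u n - l) / (u n * l)).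
  by field; rewrite u0 l0.
rewrite absvN (absvM hv) absvV (absvM hv) hN // ltr_pdivrMr ?mulr_gt0 //.
exact: hM.
Qed.

Lemma absv_cvg_le u l e N : cvg_abs v u l ->
  (forall n, (N <= n)%N -> v (u n) <= e) -> v l <= e.
Proof.
move=> hu h; have [->|l0] := eqVneq l 0.
  by rewrite absv0; apply: le_trans (h N _); rewrite ?(absv_ge0 hv).
have [M hM] := cvg_abs_near hu l0.
by rewrite -(hM _ (leq_maxr N M)); apply: h; exact: leq_maxl.
Qed.

Lemma absv_cvg_eq u l e N : cvg_abs v u l -> 0 < e ->
  (forall n, (N <= n)%N -> v (u n) = e) -> v l = e.
Proof.
move=> /cvg_absP hu e0 h; have [M hM] := hu _ e0.
pose n := maxn N M; have un : v (u n) = e by rewrite h ?leq_maxl.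
by rewrite -un; apply: absv_near; rewrite absvBC un hM ?leq_maxr.
Qed.

End AbsoluteValue.

(** * Polynomials attached to finite F-spaces *)

Section FrobeniusPower.
Variables (F : finFieldType) (L : fieldType) (s : {rmorphism F -> L}).
Local Notation q := #|F|.

Lemma card_pchar_nat : [pchar L].-nat q.
Proof.
have [p p_pr pF] := finPcharP F.
have pL : p \in [pchar L] by apply: (rmorph_pchar s).
rewrite (eq_pnat _ (pcharf_eq pL)) -cardsT.
by apply: abelian.abelem_pgroup; exact: abelian.fin_ring_pchar_abelem.
Qed.

Lemma exprD_card (x y : L) : (x + y) ^+ q = x ^+ q + y ^+ q.
Proof. exact: exprDn_pchar card_pchar_nat. Qed.

Lemma exprD_cardX n (x y : L) : (x + y) ^+ (q ^ n) = x ^+ (q ^ n) + y ^+ (q ^ n).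
Proof. by apply: exprDn_pchar; rewrite pnatX card_pchar_nat. Qed.

Lemma expr_card_cst c : s c ^+ q = s c.
Proof. by rewrite -rmorphXn expf_card. Qed.

Lemma expr_cardX_cst n c : s c ^+ (q ^ n) = s c.
Proof. by elim: n => [|n ih]; rewrite ?expr1 // expnSr exprM ih expr_card_cst. Qed.

Lemma exprN_cardX n (x : L) : (- x) ^+ (q ^ n) = - x ^+ (q ^ n).
Proof.
have h := exprD_cardX n x (- x); rewrite subrr expr0n in h.
apply/eqP; rewrite -addr_eq0 addrC -h.
by rewrite expn_eq0 (gtn_eqF (ltnW (finNzRing_gt1 F))).
Qed.

Lemma exprB_card (x y : L) : (x - y) ^+ q = x ^+ q - y ^+ q.
Proof. by rewrite exprD_card -(expn1 q) exprN_cardX. Qed.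

Lemma prod_sub_cst (y : L) : \prod_(c : F) (y - s c) = y ^+ q - y.
Proof.
have := congr1 (fun p => (map_poly s p).[y]) (finField_genPoly F).
rewrite /= rmorphB rmorphXn /= map_polyX !hornerE rmorph_prod horner_prod => ->.
by apply: eq_bigr => c _; rewrite rmorphB /= map_polyX map_polyC !hornerE.
Qed.

(* Reindexing by c -> 1/c turns the reversed polynomial 1 - y^(q-1) into the
   product of the 1 - c y. *)
Lemma prod_cst_root (y : L) :
  \prod_(c : F | c != 0) (1 - y / s c) = 1 - y ^+ q.-1.
Proof.
have [->|y0] := eqVneq y 0.
  rewrite expr0n -subn1 subn_eq0 leqNgt finNzRing_gt1 subr0.
  by rewrite big1 // => c _; rewrite mul0r subr0.
have q0 : (0 < q)%N by exact: ltnW (finNzRing_gt1 F).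
have yq : y * (1 - y ^+ q.-1) = y - y ^+ q.
  by rewrite mulrBr mulr1 -exprS prednK.
apply: (mulfI y0); rewrite yq.
have := prod_sub_cst y^-1; rewrite (bigD1 0) //= rmorph0 subr0.
rewrite (reindex_inj (@invr_inj F)) /=.
under eq_bigl do rewrite invr_eq0.
under eq_bigr do rewrite fmorphV.
move=> h.
have hc : \prod_(c : F | c != 0) (1 - y / s c) =
    y ^+ q.-1 * \prod_(c : F | c != 0) (y^-1 - (s c)^-1).
  rewrite -(cardC1 (0 : F)) -prodr_const -big_split /=.
  by apply: eq_bigr => c c0; rewrite mulrBr divff.
rewrite hc mulrA -exprS prednK //.
set P := \prod_(_ | _) _ in h *.
have -> : y ^+ q * P = y ^+ q * y * (y^-1 * P) by rewrite -mulrA mulVKf.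
rewrite h exprVn mulrBr mulrAC divff ?mul1r ?expf_neq0 //.
by rewrite -mulrA divff // mulr1.
Qed.

End FrobeniusPower.

(** * Finite F-spaces and their F-linear product polynomials *)

Section FiniteSpan.
Variables (F : finFieldType) (L : fieldType) (s : {rmorphism F -> L}).
Local Notation q := #|F|.

(** A list rather than a set, so that products over the span are big operators split into cosets of
    the span of the tail. Freeness of [ws] excludes repetitions ([lspan_uniq]). *)
Fixpoint lspan (ws : seq L) : seq L :=
  if ws is w :: ws' then [seq s c * w + x | c <- enum F, x <- lspan ws']
  else [:: 0].

Fixpoint lfree (ws : seq L) : bool :=
  if ws is w :: ws' then (w \notin lspan ws') && lfree ws' else true.

(* The F-linear polynomial x * \prod_(0 != l in span ws) (1 - x / l), computed
   by adjoining the basis vectors one at a time (see lspan_expE). *)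
Fixpoint lspan_exp (ws : seq L) (x : L) : L :=
  if ws is w :: ws' then
    let y := lspan_exp ws' x in y - y ^+ q / lspan_exp ws' w ^+ q.-1
  else x.

Lemma lspan_consP w ws x :
  reflect (exists c y, y \in lspan ws /\ x = s c * w + y) (x \in lspan (w :: ws)).
Proof.
apply: (iffP allpairsP) => [[[c y] /= [_ hy ->]]|[c [y [hy ->]]]].
  by exists c, y.
by exists (c, y); rewrite mem_enum.
Qed.

Lemma lspan0 ws : 0 \in lspan ws.
Proof.
elim: ws => [|w ws ih]; first by rewrite inE.
by apply/lspan_consP; exists 0, 0; rewrite rmorph0 mul0r addr0.
Qed.

Lemma lspan_lin ws c x y :
  x \in lspan ws -> y \in lspan ws -> s c * x + y \in lspan ws.
Proof.
elim: ws x y => [|w ws ih] x y.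
  by rewrite !inE => /eqP -> /eqP ->; rewrite mulr0 addr0.
move=> /lspan_consP[d [x' [hx ->]]] /lspan_consP[e [y' [hy ->]]].
apply/lspan_consP; exists (c * d + e), (s c * x' + y'); split; first exact: ih.
by rewrite rmorphD rmorphM; ring.
Qed.

Lemma lspan_map t ws : lspan (map ( *%R t) ws) = map ( *%R t) (lspan ws).
Proof.
elim: ws => [|w ws ih] /=; first by rewrite mulr0.
rewrite ih map_allpairs allpairs_mapr.
by apply: eq_allpairs => // c x; rewrite mulrDr mulrCA.
Qed.

Lemma lfree_map t ws : t != 0 -> lfree (map ( *%R t) ws) = lfree ws.
Proof.
move=> t0; elim: ws => //= w ws ->.
by rewrite lspan_map mem_map //; exact: mulfI.
Qed.

Lemma lspan_uniq ws : lfree ws -> uniq (lspan ws).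
Proof.
elim: ws => //= w ws ih /andP[hw /ih u].
apply: allpairs_uniq => //; first exact: enum_uniq.
move=> [c x] [d y] /allpairsP[[c' x'] /= [_ hx [-> ->]]].
move=> /allpairsP[[d' y'] /= [_ hy [-> ->]]] /= e.
have [cd|cd] := eqVneq c' d'; first by move: e; rewrite cd => /addrI ->.
have cd0 : s (c' - d') != 0 by rewrite fmorph_eq0 subr_eq0.
case/negP: hw.
(* Equal vectors with different coefficients of [w] can be solved for [w], which would put it in the
   smaller span. *)
have -> : w = s (c' - d')^-1 * (s (- 1) * x' + y') + 0.
  apply: (mulfI cd0); rewrite addr0 fmorphV mulVKf // rmorphN rmorph1 mulN1r.
  rewrite rmorphB mulrBl -[s c' * w](addrK x') e; ring.
by apply: lspan_lin (lspan0 _); exact: lspan_lin.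
Qed.

Lemma lspan_expD ws x y :
  lspan_exp ws (x + y) = lspan_exp ws x + lspan_exp ws y.
Proof.
elim: ws => //= w ws ih.
by rewrite ih (exprD_card s) mulrDl opprD addrACA.
Qed.

Lemma lspan_expZ ws c x : lspan_exp ws (s c * x) = s c * lspan_exp ws x.
Proof.
elim: ws => //= w ws ih.
by rewrite ih exprMn expr_card_cst -mulrA -mulrBr.
Qed.

Lemma lspan_expN ws x : lspan_exp ws (- x) = - lspan_exp ws x.
Proof. by have := lspan_expZ ws (-1) x; rewrite rmorphN rmorph1 !mulN1r. Qed.

Lemma lspan_exp0 ws : lspan_exp ws 0 = 0.
Proof. by have := lspan_expZ ws 0 0; rewrite rmorph0 !mul0r. Qed.

Lemma prod_neq0_cond (r : seq L) (f : L -> L) (P : pred L) :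
  (forall x, x \in r -> P x -> f x != 0) -> \prod_(x <- r | P x) f x != 0.
Proof.
move=> h; rewrite big_seq_cond.
by apply: (big_ind (fun x => x != 0)) => [|x y|x /andP[]];
  rewrite ?oner_neq0 //; [exact: mulf_neq0|exact: h].
Qed.

(** Write E for the polynomial of the tail [ws] and group the vectors c w + y by c. The part c = 0
    gives E(x). For c != 0 the coset contributes E(c w - x) / E(c w) = 1 - E(x) / (c E(w)), and the
    product of these over c is 1 - (E(x) / E(w))^(q-1) by [prod_cst_root]. *)
Lemma lspan_expE ws x : lfree ws ->
  lspan_exp ws x = x * \prod_(l <- lspan ws | l != 0) (1 - x / l).
Proof.
elim: ws x => [|w ws ih] x.
  by rewrite /= big_cons eqxx /= big_nil mulr1.
move=> fr; have /andP[/= hw hws] := fr.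
have hwc c y : c != 0 -> y \in lspan ws -> s c * w + y != 0.
  move=> c0 hy; apply: contra hw => /eqP e.
  have -> : w = s (- c^-1) * y + 0.
    have sc0 : s c != 0 by rewrite fmorph_eq0.
    apply: (mulfI sc0); rewrite addr0 rmorphN fmorphV mulNr mulrN mulVKf //.
    by apply/eqP; rewrite -addr_eq0 e.
  by apply: lspan_lin; rewrite ?lspan0.
pose K := \prod_(l <- lspan ws | l != 0) l.
have K0 : K != 0 by apply: prod_neq0_cond.
(* Up to the constant [K], the product over a translate of the span is a value of [lspan_exp]; this
   evaluates numerator and denominator of each coset product. *)
have shiftE y : \prod_(l <- lspan ws) (y + l) = lspan_exp ws y * K.
  have -> : lspan_exp ws y = y * \prod_(l <- lspan ws | l != 0) (1 + y / l).
    rewrite -[LHS]opprK -lspan_expN ih // mulNr opprK; congr (_ * _).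
    by apply: eq_bigr => l _; rewrite mulNr opprK.
  rewrite -mulrA /K -big_split /=.
  rewrite (bigD1_seq 0) ?lspan0 ?lspan_uniq //= addr0; congr (_ * _).
  by apply: eq_bigr => l l0; rewrite mulrDl mul1r divfK // addrC.
have ew : lspan_exp ws w != 0.
  rewrite -(mulIr_eq0 _ (mulIf K0)) -shiftE.
  rewrite big_seq; apply: (big_ind (fun x => x != 0)) => [|a b|y hy].
  - exact: oner_neq0.
  - exact: mulf_neq0.
  - by rewrite -(mul1r w) -(rmorph1 s) hwc // oner_neq0.
have inner c : c != 0 ->
    \prod_(y <- lspan ws)
       (if s c * w + y != 0 then 1 - x / (s c * w + y) else 1) =
    1 - lspan_exp ws x / lspan_exp ws w / s c.
  move=> c0; have sc0 : s c != 0 by rewrite fmorph_eq0.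
  transitivity (\prod_(y <- lspan ws) ((s c * w - x + y) / (s c * w + y))).
    rewrite big_seq [RHS]big_seq; apply: eq_bigr => y hy.
    by rewrite hwc //; field; exact: hwc.
  rewrite prodf_div !shiftE lspan_expD lspan_expN lspan_expZ.
  by field; rewrite K0 ew sc0.
rewrite /= big_mkcond big_allpairs_dep big_enum /=.
rewrite (bigD1 0) //= (eq_bigr _ inner) prod_cst_root rmorph0 mul0r.
under eq_bigr do rewrite add0r.
rewrite -big_mkcond /= mulrA -ih // mulrBr mulr1 expr_div_n mulrA -exprS prednK //.
exact: ltnW (finNzRing_gt1 F).
Qed.

Lemma lspan_exp_eq0 ws x : lfree ws -> (lspan_exp ws x == 0) = (x \in lspan ws).
Proof.
move=> fr; have [->|x0] := eqVneq x 0; first by rewrite lspan_exp0 eqxx lspan0.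
rewrite lspan_expE // mulf_eq0 (negPf x0) /=; apply/idP/idP => [|hx].
  apply: contraLR => hx; apply: prod_neq0_cond => l hl l0.
  rewrite subr_eq0 eq_sym; apply: contra hx => /eqP h.
  by rewrite -(divfK l0 x) h mul1r.
by rewrite (big_rem x) //= x0 divff // subrr mul0r.
Qed.

(** Each step is homogeneous of degree 1, as t^q / t^(q-1) = t. With t = T this carries a span to T
    times it, the source of the functional equation. *)
Lemma lspan_exp_map t ws x : t != 0 ->
  lspan_exp (map ( *%R t) ws) (t * x) = t * lspan_exp ws x.
Proof.
move=> t0; elim: ws x => //= w ws ih x.
have hq : t ^+ q = t * t ^+ q.-1.
  by rewrite -exprS prednK //; exact: ltnW (finNzRing_gt1 F).
rewrite !ih !exprMn invfM hq mulrBr; congr (_ - _).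
by rewrite -!mulrA; congr (_ * _); rewrite mulrCA mulVKf // expf_neq0.
Qed.

End FiniteSpan.

(** * The place at infinity *)

Section InftyPlace.
Variables (F : finFieldType) (R : realType) (C : fieldType).
Variables (iota : {rmorphism ratfun F -> C}) (abs : C -> R).
Hypothesis hv : absolute_value abs.
Hypothesis hn : extends_infty iota abs.
Local Notation q := #|F|.

Definition pol_map : {rmorphism {poly F} -> C} := iota \o @tofrac {poly F}.
Definition cst_map : {rmorphism F -> C} := pol_map \o polyC.
Local Notation pol := pol_map.
Local Notation cst := cst_map.
Local Notation T := (pol 'X).

Lemma pol_mapE p : iota p%:F = pol p. Proof. by []. Qed.

Lemma cst_mapE c : pol c%:P = cst c. Proof. by []. Qed.

Lemma card_gt1 : 1 < q%:R :> R.
Proof. by rewrite ltr1n finNzRing_gt1. Qed.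

Lemma card_gt0 : 0 < q%:R :> R.
Proof. exact: lt_trans ltr01 card_gt1. Qed.

Lemma pol_eq0 p : (pol p == 0) = (p == 0).
Proof. by rewrite -pol_mapE fmorph_eq0 tofrac_eq0. Qed.

Lemma abs_pol p : p != 0 -> abs (pol p) = q%:R ^+ (size p).-1.
Proof. exact: hn. Qed.

Lemma abs_T : abs T = q%:R.
Proof. by rewrite abs_pol ?polyX_eq0 // size_polyX expr1. Qed.

Lemma T_neq0 : T != 0.
Proof. by rewrite pol_eq0 polyX_eq0. Qed.

Lemma abs_cst c : c != 0 -> abs (cst c) = 1.
Proof. by move=> c0; rewrite -cst_mapE abs_pol ?polyC_eq0 // size_polyC c0. Qed.

Lemma abs_cst_le1 c : abs (cst c) <= 1.
Proof. by have [->|c0] := eqVneq c 0; rewrite ?rmorph0 ?(absv0 hv) ?abs_cst. Qed.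

Lemma abs_pol_le p1 p2 : (abs (pol p1) <= abs (pol p2)) = (size p1 <= size p2)%N.
Proof.
have [->|p10] := eqVneq p1 0.
  by rewrite rmorph0 (absv0 hv) (absv_ge0 hv) size_poly0.
have [->|p20] := eqVneq p2 0.
  rewrite rmorph0 (absv0 hv) size_poly0 leqn0 size_poly_eq0 (negPf p10).
  by apply/negbTE; rewrite -ltNge (absv_gt0 hv) pol_eq0.
rewrite !abs_pol // ler_eXn2l ?card_gt1 //.
by rewrite -(leq_add2r 1) !addn1 !prednK // size_poly_gt0.
Qed.

Lemma abs_pol_lt p1 p2 : (abs (pol p1) < abs (pol p2)) = (size p1 < size p2)%N.
Proof. by rewrite ltNge abs_pol_le -ltnNge. Qed.

Lemma abs_pol_ge1 p : p != 0 -> 1 <= abs (pol p).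
Proof. by move=> p0; rewrite abs_pol // exprn_ege1 // ltW ?card_gt1. Qed.

Lemma abs_pol_discrete p1 p2 :
  abs (pol p1) < abs (pol p2) -> q%:R * abs (pol p1) <= abs (pol p2).
Proof.
rewrite -abs_T -(absvM hv) -rmorphM abs_pol_lt abs_pol_le mulrC.
have [->|p0] := eqVneq p1 0; first by rewrite mul0r size_poly0.
by rewrite size_mulX.
Qed.

Lemma abs_pol_digit p1 p2 : p2 != 0 -> abs (pol p1) <= abs (pol p2) ->
  exists e, abs (pol p1 - cst e * pol p2) < abs (pol p2).
Proof.
move=> p20; rewrite abs_pol_le => h.
(* The coefficient of [p1] is taken at the degree of [p2], so the digit is 0 when [p1] has smaller
   degree. *)
exists (p1`_(size p2).-1 / lead_coef p2).
rewrite -cst_mapE -rmorphM -rmorphB abs_pol_lt.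
rewrite -[ltnRHS]prednK ?size_poly_gt0 // ltnS.
apply/leq_sizeP => j; rewrite coefB coefCM.
rewrite leq_eqVlt => /orP[/eqP <-|hj].
  by rewrite divfK ?lead_coef_eq0 // subrr.
have hj2 : (size p2 <= j)%N by exact: leq_trans (leqSpred _) hj.
by rewrite (nth_default 0 hj2) (nth_default 0 (leq_trans h hj2)) mulr0 subrr.
Qed.

Definition rational (x : C) : Prop :=
  exists p1 p2, p2 != 0 /\ x = pol p1 / pol p2.

Lemma rational_pol p : rational (pol p).
Proof. by exists p, 1; rewrite oner_neq0 rmorph1 divr1. Qed.

Lemma rational_cst c : rational (cst c).
Proof. by rewrite -cst_mapE; exact: rational_pol. Qed.

Lemma rationalD x y : rational x -> rational y -> rational (x + y).
Proof.
move=> [p1 [p2 [p20 ->]]] [p3 [p4 [p40 ->]]].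
exists (p1 * p4 + p3 * p2), (p2 * p4); rewrite mulf_neq0 //; split=> //.
by rewrite rmorphD !rmorphM /=; field; rewrite !pol_eq0 p20 p40.
Qed.

Lemma rationalM x y : rational x -> rational y -> rational (x * y).
Proof.
move=> [p1 [p2 [p20 ->]]] [p3 [p4 [p40 ->]]].
exists (p1 * p3), (p2 * p4); rewrite mulf_neq0 //; split=> //.
by rewrite !rmorphM /=; field; rewrite !pol_eq0 p20 p40.
Qed.

Lemma rationalV x : rational x -> rational x^-1.
Proof.
move=> [p1 [p2 [p20 ->]]]; have [->|p10] := eqVneq p1 0.
  by rewrite rmorph0 mul0r invr0 -(rmorph0 pol); exact: rational_pol.
by exists p2, p1; rewrite invf_div.
Qed.

Lemma rationalX x n : rational x -> rational (x ^+ n).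
Proof.
move=> hx; elim: n => [|n ih]; last by rewrite exprS; exact: rationalM.
by rewrite expr0 -(rmorph1 pol); exact: rational_pol.
Qed.

(** Nonzero elements of k have powers of q as absolute values, so a strict inequality gains a factor
    q. *)
Lemma rational_discrete x y : rational x -> rational y ->
  abs x < abs y -> abs x <= abs y / q%:R.
Proof.
move=> [p1 [p2 [p20 ->]]] [p3 [p4 [p40 ->]]].
have p2g : 0 < abs (pol p2) by rewrite (absv_gt0 hv) pol_eq0.
have p4g : 0 < abs (pol p4) by rewrite (absv_gt0 hv) pol_eq0.
rewrite !(absvM hv) !(absvV hv) ltr_pdivrMr // mulrAC ltr_pdivlMr //.
rewrite -!(absvM hv) -!rmorphM => /abs_pol_discrete.
rewrite !rmorphM !(absvM hv) => h.
by rewrite ler_pdivlMr ?card_gt0 // mulrAC ler_pdivrMr // mulrAC ler_pdivlMr //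
  -mulrA mulrC -mulrA [_ * abs (pol p1)]mulrC.
Qed.

Lemma rational_digit x y : rational x -> rational y -> y != 0 ->
  abs x <= abs y -> exists e, abs (x - cst e * y) < abs y.
Proof.
move=> [p1 [p2 [p20 ->]]] [p3 [p4 [p40 ->]]] y0.
have p2g : 0 < abs (pol p2) by rewrite (absv_gt0 hv) pol_eq0.
have p4g : 0 < abs (pol p4) by rewrite (absv_gt0 hv) pol_eq0.
have p30 : p3 != 0.
  by apply: contra y0 => /eqP ->; rewrite rmorph0 mul0r.
move=> h; have {}h : abs (pol (p1 * p4)) <= abs (pol (p3 * p2)).
  by move: h; rewrite !(absvM hv) !(absvV hv) ler_pdivrMr // mulrAC ler_pdivlMr //
    -!(absvM hv) -!rmorphM.
have [e he] := abs_pol_digit (mulf_neq0 p30 p20) h; exists e.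
have -> : pol p1 / pol p2 - cst e * (pol p3 / pol p4) =
   (pol (p1 * p4) - cst e * pol (p3 * p2)) / (pol p2 * pol p4).
  by rewrite !rmorphM /=; field; rewrite !pol_eq0 p20 p40.
rewrite !(absvM hv) !(absvV hv) (absvM hv) ltr_pdivrMr ?mulr_gt0 //.
by rewrite [ltRHS]mulrACA mulVf ?(gt_eqF p4g) // mulr1 -(absvM hv) -rmorphM.
Qed.

End InftyPlace.

(** * Quadratic irrationals outside F((1/T)) *)

Lemma odd_card_2neq0 (F : finFieldType) : odd #|F| -> (2%:R : F) != 0.
Proof.
move=> qodd; apply/negP => h2.
have p2 : 2%N \in [pchar F] by rewrite inE /= h2.
have := card_pchar_nat (idfun : {rmorphism F -> F}).
rewrite (eq_pnat _ (pcharf_eq p2)) => /p_natP[[|k] hk].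
  by have := finNzRing_gt1 F; rewrite hk.
by move: qodd; rewrite hk oddX.
Qed.

Lemma card_exp_gt (F : finFieldType) (R : realType) (x : R) :
  exists M, forall n, (M <= n)%N -> x < #|F|%:R ^+ n.
Proof.
exists (Num.bound `|x|) => n hn; apply: le_lt_trans (ler_norm x) _.
apply: lt_le_trans (archi_boundP (normr_ge0 x)) _.
rewrite -natrX ler_nat; apply: leq_trans hn _.
by apply: ltnW; apply: ltn_expl; exact: finNzRing_gt1.
Qed.

Section QuadraticIrrational.
Variables (F : finFieldType) (R : realType) (C : fieldType).
Variables (iota : {rmorphism ratfun F -> C}) (abs : C -> R).
Hypothesis hv : absolute_value abs.
Hypothesis hn : extends_infty iota abs.
Hypothesis hq : odd #|F|.
Local Notation q := #|F|.
Local Notation pol := (pol_map iota).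
Local Notation cst := (cst_map iota).
Local Notation T := (pol 'X).

Lemma abs_mul2 x : abs (2%:R * x) = abs x.
Proof.
have -> : 2%:R = cst 2%:R :> C by rewrite rmorph_nat.
by rewrite (absvM hv) (abs_cst hn) ?mul1r ?odd_card_2neq0.
Qed.

Lemma two_neq0 : 2%:R != 0 :> C.
Proof.
have -> : 2%:R = cst 2%:R :> C by rewrite rmorph_nat.
by rewrite fmorph_eq0 odd_card_2neq0.
Qed.

(** * Digit expansion of a quadratic root that has a leading term *)

Section Greedy.
Variables (B D z : C) (e0 : F) (N : nat).
Hypotheses (hB : rational iota B) (hD : rational iota D).
Hypothesis hz : z ^+ 2 + B * z + D = 0.
Hypothesis Bz : abs B < abs z.
Hypothesis e0z : abs (z - cst e0 * T ^+ N) < abs z.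
Let r := abs z.

Let r_gt0 : 0 < r. Proof. exact: le_lt_trans (absv_ge0 hv _) Bz. Qed.

Let abs_lead : abs (cst e0 * T ^+ N) = r.
Proof. by rewrite /r -(absvB_eq hv e0z) opprB subrKC. Qed.

Let e0_neq0 : e0 != 0.
Proof.
apply/eqP => e00; have := r_gt0.
by rewrite -abs_lead e00 rmorph0 mul0r (absv0 hv) ltxx.
Qed.

Let rE : r = q%:R ^+ N.
Proof. by rewrite -abs_lead (absvM hv) (abs_cst hn) // mul1r (absvX hv) (abs_T hn). Qed.

(* f(x) = (x - z)(x - z') where the conjugate z' = - B - z is far from x,
   so the distance from x to z can be read off the rational number f(x). *)
Let f x := x ^+ 2 + B * x + D.

Let rational_f x : rational iota x -> rational iota (f x).
Proof. by move=> hx; rewrite /f; do !apply: rationalD => //; [exact: rationalX|exact: rationalM]. Qed.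

Let fE x : f x = (x - z) * (x + z + B).
Proof. by rewrite -[LHS]subr0 -hz /f; ring. Qed.

(** Here x + z + B is x - z' for the conjugate z'; it has leading term 2 e0 T^N because [B] is
    small, and this term has size r because 2 is invertible in F. *)
Let conj_lead x : abs (x - z) < r -> abs (x + z + B - 2%:R * (cst e0 * T ^+ N)) < r.
Proof.
move=> xz.
have -> : x + z + B - 2%:R * (cst e0 * T ^+ N) =
  2%:R * (z - cst e0 * T ^+ N) + (x - z) + B by ring.
by do !apply: (absvD_lt hv) => //; rewrite abs_mul2.
Qed.

Let abs_f x : abs (x - z) < r -> abs (f x) = abs (x - z) * r.
Proof.
move=> xz; rewrite fE (absvM hv); congr (_ * _).
by rewrite -abs_lead -[RHS]abs_mul2; apply: (absv_near hv); rewrite abs_mul2 abs_lead conj_lead.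
Qed.

(** A Newton step: the next digit of z - x is the leading digit of - f(x) divided by 2 e0, since
    f(x) = (x - z)(x - z') and x - z' is close to 2 e0 T^N. *)
Let next_digit n x : rational iota x -> abs (x - z) <= r / q%:R ^+ n ->
  (n = 0%N -> x = 0) ->
  exists e, abs (x + cst e * (T ^+ N / T ^+ n) - z) <= r / q%:R ^+ n.+1.
Proof.
move=> hx xz x0.
have q0 : 0 < q%:R :> R := card_gt0 F R.
have rTn : rational iota (T ^+ N / T ^+ n).
  by apply: rationalM; [|apply: rationalV]; apply: rationalX; exact: rational_pol.
(* A strict bound suffices: x' - z need not lie in k, but f(x') does and has size |x' - z| r, so
   discreteness of |k| supplies the missing factor q. *)
suff [e he] : exists e, abs (x + cst e * (T ^+ N / T ^+ n) - z) < r / q%:R ^+ n.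
  exists e; set x' := x + _ in he *.
  have hx' : rational iota x'.
    by apply: rationalD => //; apply: rationalM => //; exact: rational_cst.
  have x'z : abs (x' - z) < r.
    apply: lt_le_trans he _; rewrite ler_pdivrMr ?exprn_gt0 //.
    by rewrite ler_peMr ?(ltW r_gt0) // exprn_ege1 // ltW ?card_gt1.
  have rg : rational iota (T ^+ N * (T ^+ N / T ^+ n)).
    by apply: rationalM => //; apply: rationalX; exact: rational_pol.
  have agE : abs (T ^+ N * (T ^+ N / T ^+ n)) = r / q%:R ^+ n * r.
    by rewrite !(absvM hv) (absvV hv) !(absvX hv) (abs_T hn) -rE mulrC.
  have := rational_discrete hv hn (rational_f hx') rg.
  rewrite agE abs_f // ltr_pM2r // => /(_ he).
  by rewrite mulrAC ler_pM2r // exprS invfM mulrCA mulrC.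
case: n => [|n] in xz x0 rTn *.
  (* At n = 0 the point x = 0 is at distance exactly r, too far for [abs_f]; the first digit is the
     assumed leading coefficient. *)
  exists e0; rewrite x0 // add0r expr0 !divr1 (absvBC hv); exact: e0z.
have xz' : abs (x - z) < r.
  apply: le_lt_trans xz _; rewrite ltr_pdivrMr ?exprn_gt0 //.
  by rewrite ltr_pMr // exprn_egt1 // card_gt1.
set t := T ^+ N / _ in rTn *; set rho := r / _ in xz *.
have rg : rational iota (T ^+ N * t).
  by apply: rationalM => //; apply: rationalX; exact: rational_pol.
have agE : abs (T ^+ N * t) = rho * r.
  by rewrite !(absvM hv) (absvV hv) !(absvX hv) (abs_T hn) -rE mulrC.
have rho0 : 0 < rho by rewrite divr_gt0 // exprn_gt0.
have g0 : T ^+ N * t != 0 by rewrite -(absv_gt0 hv) agE mulr_gt0.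
have [|e1 he1] := rational_digit hv hn (rational_f hx) rg g0.
  by rewrite agE abs_f // ler_pM2r.
exists (- e1 / (2%:R * e0)).
have e20 : 2%:R * e0 != 0 by rewrite mulf_neq0 // odd_card_2neq0.
rewrite -(ltr_pM2r r_gt0) -{1}abs_lead -(abs_mul2 (cst e0 * T ^+ N)) -(absvM hv).
rewrite rmorphM rmorphN fmorphV rmorphM rmorph_nat.
(* The new error times 2 e0 T^N is the remainder of f(x) after its leading digit, minus (x - z)
   times the error in approximating x - z'. *)
have -> : (x + - cst e1 / (2%:R * cst e0) * t - z) * (2%:R * (cst e0 * T ^+ N)) =
    (f x - cst e1 * (T ^+ N * t)) -
    (x - z) * (x + z + B - 2%:R * (cst e0 * T ^+ N)).
  by rewrite fE; field; rewrite fmorph_eq0 e0_neq0 two_neq0.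
apply: (absvB_lt hv); first by rewrite -agE.
rewrite (absvM hv); apply: (@le_lt_trans _ _
  (rho * abs (x + z + B - 2%:R * (cst e0 * T ^+ N)))).
  by rewrite ler_wpM2r ?(absv_ge0 hv) //; exact: xz.
by rewrite ltr_pM2l // conj_lead.
Qed.

(** The default 0 never matters along [approx]: [approxP] supplies the hypotheses of [next_digit] at
    each stage. *)
Let digit n x : F :=
  xget 0 [set e | abs (x + cst e * (T ^+ N / T ^+ n) - z) <= r / q%:R ^+ n.+1].

Let approx := fix approx n : C :=
  if n is m.+1 then approx m + cst (digit m (approx m)) * (T ^+ N / T ^+ m) else 0.

Let approxP n : rational iota (approx n) /\ abs (approx n - z) <= r / q%:R ^+ n.
Proof.
elim: n => [|n [ihr ih]].
  rewrite /= sub0r (absvN hv) expr0 divr1; split=> //.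
  by rewrite -(rmorph0 pol); exact: rational_pol.
split=> /=.
  apply: rationalD => //; apply: rationalM; first exact: rational_cst.
  by apply: rationalM; [|apply: rationalV]; apply: rationalX; exact: rational_pol.
have [|e he] := next_digit ihr ih; first by case: (n).
by rewrite /digit; case: xgetP => [y _ hy|/(_ e)]; [exact: hy|case].
Qed.

Lemma quadratic_kinfty : kinfty iota abs z.
Proof.
exists N, (fun n => digit n (approx n)); apply/(cvg_absP hv) => e e_gt0.
have approxE n : approx n =
    T ^+ N * \sum_(i < n) iota (digit i (approx i))%:P%:F * T ^- i.
  elim: n => [|n ih]; first by rewrite big_ord0 mulr0.
  rewrite big_ord_recr /= mulrDr -ih; congr (_ + _).
  by rewrite mulrCA.
have [M hM] : exists M, forall n, (M <= n)%N -> r / q%:R ^+ n < e.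
  have [M hM] := card_exp_gt F (r / e); exists M => n /hM.
  by rewrite ltr_pdivrMr // mulrC -ltr_pdivrMr // exprn_gt0 // card_gt0.
exists M => n Mn; rewrite pol_mapE -approxE.
exact: le_lt_trans (approxP n).2 (hM n Mn).
Qed.

End Greedy.
End QuadraticIrrational.

(** * Absence of cancellation on the lattice A z + A *)

Section FundamentalDomain.
Variables (F : finFieldType) (R : realType) (C : fieldType).
Variables (iota : {rmorphism ratfun F -> C}) (abs : C -> R).
Hypothesis hv : absolute_value abs.
Hypothesis hn : extends_infty iota abs.
Hypothesis hq : odd #|F|.
Variables (a b c : {poly F}) (z : C).
Hypothesis hz : defining_equation iota abs a b c z.
Hypothesis zO : Omega iota abs z.
Local Notation q := #|F|.
Local Notation pol := (pol_map iota).
Local Notation cst := (cst_map iota).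
Local Notation T := (pol 'X).

Let a_neq0 : a != 0. Proof. by case: hz => _ /monic_neq0. Qed.

Let abs_a_gt0 : 0 < abs (pol a).
Proof. by rewrite (absv_gt0 hv) pol_eq0. Qed.

(** If |z| < 1, both a z^2 and b z are smaller than |a| <= |c| and cannot cancel c. *)
Lemma fundamental_abs_ge1 : 1 <= abs z.
Proof.
case: hz; rewrite !pol_mapE => eqz _ ba ac _; rewrite leNgt; apply/negP => z1.
have : abs (pol a * z ^+ 2 + pol b * z) < abs (pol a).
  apply: (absvD_lt hv); rewrite (absvM hv).
    by rewrite gtr_pMr // (absvX hv) exprn_ilt1 ?(absv_ge0 hv).
  apply: le_lt_trans ba; rewrite ler_piMr ?(absv_ge0 hv) //; exact: ltW.
have -> : pol a * z ^+ 2 + pol b * z = - pol c.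
  by apply/eqP; rewrite -addr_eq0 eqz.
by rewrite (absvN hv) ltNge ac.
Qed.

Let z_gt0 : 0 < abs z. Proof. exact: lt_le_trans ltr01 fundamental_abs_ge1. Qed.

Lemma fundamental_abs_sqr : abs (pol a) * abs z ^+ 2 = abs (pol c).
Proof.
case: hz; rewrite !pol_mapE => eqz _ ba ac _.
have -> : abs (pol c) = abs (pol a * z ^+ 2 + pol b * z).
  by rewrite -(absvN hv); congr abs; apply/eqP; rewrite eq_sym -addr_eq0 eqz.
rewrite (absvD_eq hv) (absvM hv) ?(absvX hv) // [ltRHS](absvM hv) (absvX hv).
apply: lt_le_trans (_ : abs (pol a) * abs z <= _).
  by rewrite ltr_pM2r.
by rewrite ler_pM2l // expr2 ler_peMr ?fundamental_abs_ge1 // ltW.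
Qed.

Let no_leading_term e N : ~ (abs (z - cst e * T ^+ N) < abs z).
Proof.
move=> h; apply: zO; case: hz; rewrite !pol_mapE => eqz _ ba _ _.
have pa0 : pol a != 0 by rewrite pol_eq0.
apply: (@quadratic_kinfty _ _ _ _ _ hv hn hq (pol b / pol a) (pol c / pol a) _ e N) => //.
- by apply: rationalM; [|apply: rationalV]; exact: rational_pol.
- by apply: rationalM; [|apply: rationalV]; exact: rational_pol.
- by apply: (mulfI pa0); rewrite mulr0 -eqz; field.
- apply: lt_le_trans fundamental_abs_ge1.
  by rewrite (absvM hv) (absvV hv) ltr_pdivrMr // mul1r.
Qed.

Let pol_lead p : p != 0 ->
  abs (pol p - cst (lead_coef p) * T ^+ (size p).-1) < abs (pol p).
Proof.
move=> p0; rewrite -cst_mapE -rmorphXn -rmorphM -rmorphB (abs_pol_lt hv hn) //.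
rewrite -[ltnRHS]prednK ?size_poly_gt0 // ltnS; apply/leq_sizeP => j.
rewrite coefB coefCM coefXn; case: eqP => [->|/eqP jn]; first by rewrite mulr1 subrr.
rewrite leq_eqVlt eq_sym (negPf jn) /= => hj; rewrite mulr0 subr0 nth_default //.
exact: leq_trans (leqSpred _) hj.
Qed.

(** Only a tie |u z| = |v| is in doubt. Cancellation there would make - lc(v)/lc(u) T^(deg v - deg
    u) a leading term of z, which [no_leading_term] forbids. *)
Lemma abs_lattice u v :
  abs (pol u * z + pol v) = Num.max (abs (pol u) * abs z) (abs (pol v)).
Proof.
have [|lt|eq] := ltgtP (abs (pol u) * abs z) (abs (pol v)).
- by rewrite -(absvM hv) => lt; rewrite addrC (absvD_eq hv).
- by rewrite (absvD_eq hv) ?(absvM hv).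
have [v0|v0] := eqVneq v 0; first by rewrite v0 rmorph0 addr0 (absvM hv) eq v0 rmorph0.
have u0 : u != 0.
  apply: contra_neq v0 => u0; apply/eqP; rewrite -(pol_eq0 iota) -(absv_neq0 hv).
  by rewrite -eq u0 rmorph0 (absv0 hv) mul0r.
apply/eqP; rewrite eq_le; apply/andP; split.
  by apply: (absvD_le hv); rewrite ?(absvM hv) ?eq.
rewrite leNgt; apply/negP => small.
have au0 : 0 < abs (pol u) by rewrite (absv_gt0 hv) pol_eq0.
(* Since |z| >= 1, the exponent n - m below is a true difference of natural numbers. *)
have suv : (size u <= size v)%N.
  rewrite -(abs_pol_le hv hn) -eq ler_peMr ?fundamental_abs_ge1 //.
  exact: ltW.
set m := (size u).-1; set n := (size v).-1.
have mn : (m <= n)%N by rewrite /m /n -!subn1 leq_sub2r.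
apply: (@no_leading_term (- (lead_coef v / lead_coef u)) (n - m)).
set w := cst (lead_coef u) * T ^+ m.
have lu0 : lead_coef u != 0 by rewrite lead_coef_eq0.
have cu0 : cst (lead_coef u) != 0 by rewrite fmorph_eq0.
have aw : abs w = abs (pol u).
  rewrite (absvM hv) (abs_cst hn) // mul1r (absvX hv) (abs_T hn) (abs_pol hn) //.
have w0 : 0 < abs w by rewrite aw.
rewrite -(ltr_pM2l w0) -!(absvM hv).
(* Scaling by the leading term [w] of u leaves u z + v, small by assumption, and the lower-order
   parts of u and v. *)
have -> : w * (z - cst (- (lead_coef v / lead_coef u)) * T ^+ (n - m)) =
  pol u * z + pol v - (pol u - w) * z - (pol v - cst (lead_coef v) * T ^+ n).
  rewrite rmorphN rmorphM fmorphV /= -{2}(subnK mn) exprD /w.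
  by field.
rewrite (absvM hv) aw eq.
apply: (absvB_lt hv); last exact: pol_lead.
apply: (absvB_lt hv); first by rewrite -eq.
by rewrite (absvM hv) -eq ltr_pM2r // pol_lead.
Qed.

End FundamentalDomain.

Arguments pol_map : simpl never.
Arguments cst_map : simpl never.

(** * The exponential of a lattice *)

Lemma polyXaddC_ex (K : fieldType) (p : {poly K}) : exists p' c, p = p' * 'X + c%:P.
Proof.
by elim/poly_ind: p => [|p c _]; [exists 0, 0; rewrite mul0r addr0|exists p, c].
Qed.

Lemma prod_subseq_split (K : fieldType) (S s : seq K) (P : pred K) (f : K -> K) :
  uniq S -> uniq s -> {subset s <= S} ->
  \prod_(l <- S | P l) f l =
  (\prod_(l <- s | P l) f l) * \prod_(l <- S | P l && (l \notin s)) f l.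
Proof.
move=> uS us sS; rewrite (bigID (mem s)) /=; congr (_ * _).
under eq_bigl do rewrite andbC.
rewrite -big_filter_cond; apply: perm_big; apply: uniq_perm => //.
  exact: filter_uniq.
by move=> l; rewrite mem_filter; case: (boolP (l \in s)) => //= /sS.
Qed.

Section LatticeExponential.
Variables (F : finFieldType) (R : realType) (C : fieldType).
Variables (iota : {rmorphism ratfun F -> C}) (abs : C -> R).
Hypothesis hv : absolute_value abs.
Hypothesis hn : extends_infty iota abs.
Hypothesis complete : forall u, cauchy_abs abs u -> exists l, cvg_abs abs u l.
Local Notation q := #|F|.
Local Notation pol := (pol_map iota).
Local Notation cst := (cst_map iota).
Local Notation T := (pol 'X).
Variable z : C.
Hypothesis z_ge1 : 1 <= abs z.
Hypothesis abs_lat : forall u v,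
  abs (pol u * z + pol v) = Num.max (abs (pol u) * abs z) (abs (pol v)).
Local Notation Lambda := (lattice iota z).

(** Level n+1 is z, 1 and T times level n, instead of level n with top monomials appended: this is
    the shape from which [lattice_exp_mulT] is read off. *)
Fixpoint lattice_basis (n : nat) : seq C :=
  if n is m.+1 then z :: 1 :: map ( *%R T) (lattice_basis m) else [::].

Let spanL n := lspan cst (lattice_basis n).

Let abs_T_gt0 : 0 < abs T. Proof. by rewrite (abs_T hn) card_gt0. Qed.

Lemma lattice_basisP n x :
  reflect (exists u v : {poly F}, [/\ (size u <= n)%N, (size v <= n)%N & x = pol u * z + pol v])
    (x \in lspan cst (lattice_basis n)).
Proof.
apply: (iffP idP); elim: n x => [|n ih] x.
- rewrite inE => /eqP ->; exists 0, 0.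
  by rewrite size_poly0 rmorph0 mul0r addr0.
- move=> /lspan_consP[c [_ [/lspan_consP[d [y [hy ->]]] ->]]].
  move: hy; rewrite lspan_map => /mapP[_ /ih[u [v [su sv ->]]] ->].
  exists (u * 'X + c%:P), (v * 'X + d%:P).
  rewrite !size_MXaddC; split; try by case: ifP.
  by rewrite !rmorphD !rmorphM !cst_mapE; ring.
- move=> [u [v [su sv ->]]].
  move: su sv; rewrite !leqn0 !size_poly_eq0 => /eqP -> /eqP ->.
  by rewrite rmorph0 mul0r addr0 inE.
- move=> [u [v []]].
  have [u' [c ->]] := polyXaddC_ex u; have [v' [d ->]] := polyXaddC_ex v.
  move=> su sv ->.
  have size_le p e : (size (p * 'X + e%:P)%R <= n.+1)%N -> (size (p : {poly F}) <= n)%N.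
    rewrite size_MXaddC; case: ifP => // /andP[/eqP -> _]; by rewrite size_poly0.
  apply/lspan_consP; exists c, (cst d * 1 + T * (pol u' * z + pol v')); split.
    apply/lspan_consP; exists d, (T * (pol u' * z + pol v')); split=> //.
    rewrite lspan_map; apply/map_f/ih; exists u', v'; split=> //.
      exact: size_le su.
    exact: size_le sv.
  by rewrite !rmorphD !rmorphM !cst_mapE; ring.
Qed.

Lemma lattice_abs_ge1 l : Lambda l -> l != 0 -> 1 <= abs l.
Proof.
move=> [u [v ->]]; rewrite !pol_mapE => l0; rewrite abs_lat le_max.
have [v0|v0] := eqVneq v 0; last by rewrite (abs_pol_ge1 hn v0) orbT.
have u0 : u != 0.
  by apply: contra l0 => /eqP ->; rewrite v0 !rmorph0 mul0r addr0.
by rewrite -[1]mulr1 ler_pM // (abs_pol_ge1 hn u0).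
Qed.

Lemma lattice_coord_eq0 u v : pol u * z + pol v = 0 -> u = 0.
Proof.
move=> h; apply/eqP; apply: contraT => u0.
have : abs (pol u) * abs z <= 0.
  by rewrite -(absv0 hv) -h abs_lat le_max lexx.
by rewrite leNgt mulr_gt0 ?(absv_gt0 hv) ?pol_eq0 // -(absv_gt0 hv) (lt_le_trans ltr01).
Qed.

Lemma lattice_notin_span l n : Lambda l -> l \notin lspan cst (lattice_basis n) ->
  q%:R ^+ n <= abs l.
Proof.
move=> [u [v ->]]; rewrite !pol_mapE abs_lat le_max => hl.
have abs_ge (p : {poly F}) : ~~ (size p <= n)%N -> q%:R ^+ n <= abs (pol p).
  rewrite -ltnNge => hp.
  have p0 : p != 0 by rewrite -size_poly_gt0; exact: leq_ltn_trans hp.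
  rewrite (abs_pol hn p0) ler_eXn2l ?card_gt1 //.
  by rewrite -ltnS prednK // size_poly_gt0.
have [su|/abs_ge hu] := boolP (size u <= n)%N; last first.
  by rewrite (le_trans hu) // ler_peMr ?(absv_ge0 hv).
have [sv|/abs_ge hv'] := boolP (size v <= n)%N; last by rewrite hv' orbT.
by case/negP: hl; apply/lattice_basisP; exists u, v.
Qed.

Lemma span_lattice l n : l \in lspan cst (lattice_basis n) -> Lambda l.
Proof. by move=> /lattice_basisP[u [v [_ _ ->]]]; exists u, v. Qed.

(** Comparing coordinates along z would make 1 divisible by 'X. This is independence of z and 1
    modulo T times the lattice, hence of z/T and 1/T modulo the lattice. *)
Lemma lattice_z_notin d l : Lambda l -> z <> cst d + T * l.
Proof.
move=> [u [v ->]] h; rewrite !pol_mapE in h.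
have : pol (1 - u * 'X) * z + pol (- (v * 'X + d%:P)) = 0.
  rewrite rmorphB rmorphN rmorphD !rmorphM rmorph1 cst_mapE.
  by rewrite mulrBl mul1r {1}h; ring.
move=> /lattice_coord_eq0 /(congr1 (fun p : {poly F} => p`_0)).
by rewrite coefB coef1 coefMX subr0 coef0 => /eqP; rewrite oner_eq0.
Qed.

Let one_notin_TL l : Lambda l -> 1 <> T * l.
Proof.
move=> hl h; have l0 : l != 0.
  by apply/eqP => l0; move/eqP: h; rewrite l0 mulr0 oner_eq0.
have := lattice_abs_ge1 hl l0; rewrite leNgt => /negP; apply.
by rewrite -(ltr_pM2l abs_T_gt0) -(absvM hv) -h (absv1 hv) mulr1 (abs_T hn) card_gt1.
Qed.

Lemma lfree_lattice_basis n : lfree cst (lattice_basis n).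
Proof.
elim: n => // n ih.
have consE w ws : lfree cst (w :: ws) = (w \notin lspan cst ws) && lfree cst ws by [].
rewrite !consE lfree_map ?T_neq0 // ih andbT; apply/andP; split.
  apply/negP => /lspan_consP[d [y [hy e]]].
  move: hy; rewrite lspan_map => /mapP[l /span_lattice hl yE].
  by apply: (lattice_z_notin (d := d) hl); rewrite e yE mulr1.
by rewrite lspan_map; apply/negP => /mapP[l /span_lattice hl]; exact: one_notin_TL.
Qed.

Let En n x := lspan_exp F (lattice_basis n) x.

Let EnE n x : En n x = x * \prod_(l <- spanL n | l != 0) (1 - x / l).
Proof. exact: lspan_expE (lfree_lattice_basis n). Qed.

Let partial (x : C) (S : seq C) : C :=
  x * \prod_(l <- S | (l \in Lambda) && (l != 0)) (1 - x / l).

Let partial_span n x : partial x (spanL n) = En n x.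
Proof.
rewrite EnE /partial; congr (_ * _); rewrite big_seq_cond [RHS]big_seq_cond.
apply: eq_bigl => l; case: (boolP (l \in spanL n)) => //= hl.
by rewrite mem_set //; exact: span_lattice hl.
Qed.

(** Every extra lattice vector has size at least q^n, so the extra factors multiply to within |x| /
    q^n of 1. As [S] is an arbitrary finite superset, the estimate controls the net and not only the
    sequence of spans. *)
Let partial_near n x (S : seq C) : uniq S -> {subset spanL n <= S} ->
  abs x <= q%:R ^+ n ->
  abs (partial x S - En n x) <= abs (En n x) * (abs x / q%:R ^+ n).
Proof.
move=> uS sS xn; have qn0 : 0 < q%:R ^+ n :> R by rewrite exprn_gt0 // card_gt0.
rewrite /partial (prod_subseq_split _ _ uS _ sS); last first.
  exact/lspan_uniq/lfree_lattice_basis.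
rewrite mulrA -/(partial x (spanL n)) partial_span.
rewrite -{2}[En n x]mulr1 -mulrBr (absvM hv) ler_wpM2l ?(absv_ge0 hv) //.
apply: (absv_prod1 hv) => [|l _ /andP[/andP[/set_mem hl l0] hln]].
  by rewrite divr_ge0 ?(absv_ge0 hv) ?(ltW qn0) //= ler_pdivrMr // mul1r.
have ln := lattice_notin_span hl hln.
rewrite (absvM hv) (absvV hv) ler_wpM2l ?(absv_ge0 hv) // lef_pV2 ?posrE //.
exact: lt_le_trans ln.
Qed.

Let En_near n m x : (n <= m)%N -> abs x <= q%:R ^+ n ->
  abs (En m x - En n x) <= abs (En n x) * (abs x / q%:R ^+ n).
Proof.
move=> nm xn; rewrite -[En m x]partial_span; apply: partial_near => //.
  exact/lspan_uniq/lfree_lattice_basis.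
move=> l /lattice_basisP[u [v [su sv ->]]]; apply/lattice_basisP; exists u, v.
by rewrite (leq_trans su nm) (leq_trans sv nm).
Qed.

(** As soon as |x| < q^N the relative error is below 1, and the absolute value is frozen. *)
Lemma lattice_exp_stable x : exists N, forall n, (N <= n)%N ->
  abs x <= q%:R ^+ n /\
  abs (lspan_exp F (lattice_basis n) x) = abs (lspan_exp F (lattice_basis N) x).
Proof.
have [N hN] := card_exp_gt F (abs x); exists N => n Nn.
split; first exact/ltW/hN.
rewrite -/(En n x) -/(En N x).
have [E0|E0] := eqVneq (En N x) 0.
  have := En_near Nn (ltW (hN N (leqnn _))).
  by rewrite E0 (absv0 hv) mul0r subr0 => h; apply/le_anti; rewrite h (absv_ge0 hv).
apply: (absv_near hv); apply: le_lt_trans (En_near Nn (ltW (hN N (leqnn _)))) _.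
rewrite gtr_pMr ?(absv_gt0 hv) // ltr_pdivrMr ?exprn_gt0 ?card_gt0 // mul1r.
exact: hN.
Qed.

Let En_small x e : 0 < e -> exists N, forall n, (N <= n)%N ->
  abs x <= q%:R ^+ n /\ abs (En n x) * (abs x / q%:R ^+ n) < e.
Proof.
move=> e0; have [N hN] := lattice_exp_stable x.
have [M hM] := card_exp_gt F (abs (En N x) * abs x / e).
exists (maxn N M) => n; rewrite geq_max => /andP[/hN[xn ->] /hM].
rewrite ltr_pdivrMr // => h; split=> //.
by rewrite mulrA ltr_pdivrMr ?exprn_gt0 ?card_gt0 // [e * _]mulrC.
Qed.

Lemma lattice_exp_cvg x :
  cvg_abs abs (fun n => lspan_exp F (lattice_basis n) x) (lattice_exp abs Lambda x).
Proof.
have [y hy] : exists y, cvg_abs abs (En ^~ x) y.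
  apply: complete => e e0; have [N hN] := En_small x e0; exists N => m n Nm Nn.
  have [xN sN] := hN _ (leqnn _).
  have -> : En m x - En n x = (En m x - En N x) - (En n x - En N x) by ring.
  by apply: (absvB_lt hv); exact: le_lt_trans (En_near _ xN) sN.
have tF : Filter (@totally C) by case: (@totally_filter C).
(* The equivalence gives existence and uniqueness of the limit of the net at once, which determines
   the value of [xget]. *)
have net_lim (w : C) : (fun S : {fset C} => abs (partial x S - w)) @ totally --> (0 : R) <->
    w = y.
  have near_y e : 0 < e -> exists A : {fset C}, forall S : {fset C},
      (A `<=` S)%fset -> abs (partial x S - y) < e.
    move=> e0; have [N1 hN1] := (cvg_absP hv _ _).1 hy _ e0.
    have [N2 hN2] := En_small x e0; pose N := maxn N1 N2.
    exists [fset l in spanL N]%fset => S /fsubsetP hS.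
    rewrite -(subrK (En N x) (partial x S)) -addrA; apply: (absvD_lt hv).
      have [xN] := hN2 N (leq_maxr _ _); apply: le_lt_trans; apply: partial_near => //; first exact: fset_uniq.
      by move=> l hl; apply: hS; rewrite !inE.
    exact: hN1 (leq_maxl _ _).
  split=> [/cvgrPdist_lt h|->].
    apply/eqP; rewrite -subr_eq0 -(absv_neq0 hv); apply: contraT => wy.
    have e0 : 0 < abs (w - y) by rewrite lt_def wy (absv_ge0 hv).
    have [A hA] := near_y _ e0; have [B _ hB] := h _ e0.
    have := hB (A `|` B)%fset (fsubsetUr _ _); have := hA _ (fsubsetUl A B).
    rewrite /= sub0r normrN ger0_norm ?(absv_ge0 hv) // => h1 h2.
    have := absvB_lt hv h1 h2.
    have -> : forall t, t - y - (t - w) = w - y by move=> t; ring.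
    by rewrite ltxx.
  apply/cvgrPdist_lt => e e0; have [A hA] := near_y _ e0; exists A => // S /= AS.
  by rewrite sub0r normrN ger0_norm ?(absv_ge0 hv) // hA.
suff -> : lattice_exp abs Lambda x = y by [].
rewrite /lattice_exp; case: xgetP => [w _ /net_lim //|/(_ y)].
by case; exact/net_lim.
Qed.

End LatticeExponential.

(** * Linearity, size estimates and functional equation of the exponential *)

Section LatticeExponentialTheory.
Variables (F : finFieldType) (R : realType) (C : fieldType).
Variables (iota : {rmorphism ratfun F -> C}) (abs : C -> R).
Hypothesis hv : absolute_value abs.
Hypothesis hn : extends_infty iota abs.
Hypothesis complete : forall u, cauchy_abs abs u -> exists l, cvg_abs abs u l.
Local Notation q := #|F|.
Local Notation pol := (pol_map iota).
Local Notation cst := (cst_map iota).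
Local Notation T := (pol 'X).
Variable z : C.
Hypothesis z_ge1 : 1 <= abs z.
Hypothesis abs_lat : forall u v,
  abs (pol u * z + pol v) = Num.max (abs (pol u) * abs z) (abs (pol v)).
Local Notation Lambda := (lattice iota z).
Local Notation e := (lattice_exp abs Lambda).
Local Notation basis := (lattice_basis iota z).
Local Notation En n x := (lspan_exp F (basis n) x).

Let cvg_e x : cvg_abs abs (fun n => En n x) (e x).
Proof. exact: (lattice_exp_cvg hv hn complete z_ge1 abs_lat). Qed.

Let EnE n x : En n x = x * \prod_(l <- lspan cst (basis n) | l != 0) (1 - x / l).
Proof. exact: lspan_expE (lfree_lattice_basis hv hn z_ge1 abs_lat n). Qed.

Lemma lattice_expD x y : e (x + y) = e x + e y.
Proof.
apply: (cvg_abs_unique hv (cvg_e _)); under eq_fun do rewrite (lspan_expD cst).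
exact: cvg_absD.
Qed.

Lemma lattice_expZ c x : e (cst c * x) = cst c * e x.
Proof.
apply: (cvg_abs_unique hv (cvg_e _)); under eq_fun do rewrite (lspan_expZ cst).
by apply: cvg_absM => //; exact: cvg_abs_cst.
Qed.

Lemma lattice_exp_abs x : exists N, forall n, (N <= n)%N -> abs (En n x) = abs (e x).
Proof.
have [N hN] := lattice_exp_stable hv hn z_ge1 abs_lat x; exists N => n Nn.
rewrite (hN n Nn).2; have [E0|E0] := eqVneq (En N x) 0.
  apply/le_anti; rewrite E0 (absv0 hv) (absv_ge0 hv) /=.
  by apply: (absv_cvg_le (N := N) hv (cvg_e x)) => m /hN[_ ->]; rewrite E0 (absv0 hv).
symmetry; apply: (absv_cvg_eq (N := N) hv (cvg_e x)); first by rewrite (absv_gt0 hv).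
by move=> m /hN[_ ->].
Qed.

Lemma lattice_exp_eq0 x : e x = 0 -> Lambda x.
Proof.
move=> ex; have [N hN] := lattice_exp_abs x.
have /eqP := hN N (leqnn _); rewrite ex (absv0 hv) (absv_neq0 hv).
rewrite (lspan_exp_eq0 (s := cst)).
  exact: span_lattice.
exact: (lfree_lattice_basis hv hn z_ge1 abs_lat).
Qed.

Lemma lattice_exp_abs_id x :
  (forall l, Lambda l -> l != 0 -> abs (1 - x / l) = 1) -> abs (e x) = abs x.
Proof.
move=> h; have [N hN] := lattice_exp_abs x; rewrite -(hN N (leqnn _)) EnE (absvM hv).
rewrite (absv_prod hv) big_seq_cond big1 ?mulr1 // => l /andP[/span_lattice hl l0].
exact: h.
Qed.

(** Compares |e(x)/x| with |e(y)/y| factor by factor; cross-multiplied to avoid division by zero. *)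
Lemma lattice_exp_abs_mono x y :
  (forall l, Lambda l -> l != 0 -> abs (1 - x / l) <= abs (1 - y / l)) ->
  abs (e x) * abs y <= abs (e y) * abs x.
Proof.
move=> h; have [N hN] := lattice_exp_abs x; have [M hM] := lattice_exp_abs y.
rewrite -(hN _ (leq_maxl N M)) -(hM _ (leq_maxr N M)) !EnE !(absvM hv).
rewrite mulrAC [leRHS]mulrAC [abs y * abs x]mulrC ler_wpM2l ?mulr_ge0 ?(absv_ge0 hv) //.
rewrite !(absv_prod hv) !(big_seq_cond (fun l => l != 0)).
by apply: ler_prod => l /andP[/span_lattice hl l0]; rewrite (absv_ge0 hv) h.
Qed.

Lemma lattice_exp_near x : abs x <= 1 -> abs (e x - x) <= abs x * abs x.
Proof.
move=> x1; apply: (absv_cvg_le (N := 0) hv).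
  by apply: (cvg_absB hv (cvg_e x)); exact: (cvg_abs_cst hv).
move=> n _ /=; rewrite EnE -{3}[x]mulr1 -mulrBr (absvM hv) ler_wpM2l ?(absv_ge0 hv) //.
apply: (absv_prod1 hv) => [|l /span_lattice hl l0]; first by rewrite (absv_ge0 hv).
rewrite (absvM hv) (absvV hv) ler_piMr ?(absv_ge0 hv) //.
by rewrite invf_le1; [|apply: lt_le_trans ltr01 _]; exact: lattice_abs_ge1 hl l0.
Qed.

Lemma lattice_exp_abs_small x : abs x < 1 -> abs (e x) = abs x.
Proof.
move=> x1; apply: lattice_exp_abs_id => l hl l0.
have l1 : 1 <= abs l by exact: lattice_abs_ge1 hl l0.
rewrite (absvB_eq hv) ?(absv1 hv) // (absvM hv) (absvV hv) ltr_pdivrMr ?mul1r.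
  exact: lt_le_trans l1.
exact: lt_le_trans l1.
Qed.

(** For u != 0, the F-linear polynomial with kernel F u and linear coefficient 1: the maps psi_i of
    the overview. *)
Definition carlitz_factor (u y : C) : C := y - y ^+ q / u ^+ q.-1.

Local Notation v1 := (e T^-1).
Local Notation v2 := (carlitz_factor v1 (e (z / T))).

Let cvg_factor (u y : nat -> C) (l m : C) : l != 0 ->
  cvg_abs abs u l -> cvg_abs abs y m ->
  cvg_abs abs (fun n => carlitz_factor (u n) (y n)) (carlitz_factor l m).
Proof.
move=> l0 ul ym; apply: (cvg_absB hv) => //; apply: (cvg_absM hv).
  exact: cvg_absX.
by apply: (cvg_absV hv); [exact: cvg_absX|rewrite expf_neq0].
Qed.

Lemma abs_lattice_exp_invT : abs v1 = q%:R^-1.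
Proof.
rewrite lattice_exp_abs_small (absvV hv) (abs_T hn) //.
by rewrite invf_lt1 ?card_gt1 // card_gt0.
Qed.

Lemma lattice_exp_invT_neq0 : v1 != 0.
Proof. by rewrite -(absv_gt0 hv) abs_lattice_exp_invT invr_gt0 card_gt0. Qed.

(** If it vanished, e(z/T)/e(1/T) would be fixed by the q-th power, hence a constant c in F; then
    e((z - c)/T) = 0 would put z - c in T times the lattice. *)
Lemma carlitz_factor_neq0 : v2 != 0.
Proof.
have v10 := lattice_exp_invT_neq0.
apply/negP => /eqP h.
pose y := e (z / T) / v1.
have hy : \prod_(c : F) (y - cst c) = 0.
  rewrite prod_sub_cst; apply: (mulIf v10); rewrite mul0r mulrBl /y.
  rewrite divfK // expr_div_n -{2}(prednK (n := q)); last exact: ltnW (finNzRing_gt1 F).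
  rewrite exprSr invfM mulrA divfK //; apply/eqP; rewrite -oppr_eq0 opprB -h.
  by rewrite /carlitz_factor.
have /eqP := hy; rewrite prodf_seq_eq0 => /hasP[c _ /=]; rewrite subr_eq0 => /eqP yc.
have : e ((z - cst c) / T) = 0.
  rewrite mulrBl lattice_expD -mulNr -rmorphN lattice_expZ rmorphN.
  by rewrite -(divfK v10 (e (z / T))) -/y yc mulNr subrr.
move=> /lattice_exp_eq0 /(lattice_z_notin hv z_ge1 abs_lat (d := c)); apply.
by rewrite mulrC divfK ?T_neq0 // addrC subrK.
Qed.

Lemma lattice_exp_mulT x :
  e (T * x) = T * carlitz_factor v2 (carlitz_factor v1 (e x)).
Proof.
have T0 := T_neq0 iota.
apply: (cvg_abs_unique hv (cvg_abs_shift hv (cvg_e _))).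
have step n : En n.+1 (T * x) =
    T * carlitz_factor (carlitz_factor (En n T^-1) (En n (z / T)))
          (carlitz_factor (En n T^-1) (En n x)).
  (* Pulling T out of the first two vectors as well turns level n+1 into T times level n enlarged by
     1/T and z/T. *)
  have -> : basis n.+1 = map ( *%R T) (z / T :: T^-1 :: basis n).
    by rewrite /= divff // mulrC divfK.
  by rewrite lspan_exp_map.
under eq_fun do rewrite step.
apply: (cvg_absM hv); first exact: (cvg_abs_cst hv).
apply: cvg_factor; first exact: carlitz_factor_neq0.
  by apply: cvg_factor => //; exact: lattice_exp_invT_neq0.
by apply: cvg_factor => //; exact: lattice_exp_invT_neq0.
Qed.

End LatticeExponentialTheory.

(** * Drinfeld modules from twisted polynomials *)

Section TwistedPolynomials.
Variables (F : finFieldType) (C : fieldType) (s0 : {rmorphism F -> C}).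
Local Notation q := #|F|.
Local Notation teval := (twisted_eval F).
Local Notation tmul := (twisted_mul F).

Let q_gt0 : (0 < q)%N. Proof. exact: ltnW (finNzRing_gt1 F). Qed.

Lemma twisted_eval_widen n (s : {poly C}) x : (size s <= n)%N ->
  teval s x = \sum_(i < n) s`_i * x ^+ (q ^ i).
Proof.
move=> sn; rewrite /twisted_eval (big_ord_widen n (fun i => s`_i * x ^+ (q ^ i))) //.
rewrite big_mkcond /=; apply: eq_bigr => i _.
by case: ltnP => // h; rewrite nth_default ?mul0r.
Qed.

Lemma twisted_evalD (s t : {poly C}) x : teval (s + t) x = teval s x + teval t x.
Proof.
pose n := maxn (size s) (size t).
rewrite (twisted_eval_widen (n := n)) ?size_polyD // (twisted_eval_widen (n := n) (s := s)) ?leq_maxl //.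
rewrite (twisted_eval_widen (n := n) (s := t)) ?leq_maxr // -big_split /=.
by apply: eq_bigr => i _; rewrite coefD mulrDl.
Qed.

Lemma twisted_evalZ c (s : {poly C}) x : teval (c *: s) x = c * teval s x.
Proof.
rewrite (twisted_eval_widen (n := size s)) ?size_scale_leq // /twisted_eval mulr_sumr.
by apply: eq_bigr => i _; rewrite coefZ mulrA.
Qed.

Lemma twisted_eval0 (x : C) : teval 0 x = 0.
Proof. by rewrite /twisted_eval size_poly0 big_ord0. Qed.

Lemma twisted_eval_sum (I : Type) (r : seq I) (P : pred I) (f : I -> {poly C}) x :
  teval (\sum_(i <- r | P i) f i) x = \sum_(i <- r | P i) teval (f i) x.
Proof.
exact: (big_morph (fun s => teval s x) (fun s t => twisted_evalD s t x) (twisted_eval0 x)).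
Qed.

Lemma twisted_evalXn n (x : C) : teval 'X^n x = x ^+ (q ^ n).
Proof.
rewrite /twisted_eval size_polyXn big_ord_recr /= coefXn eqxx mul1r big1 ?add0r //.
by move=> i _; rewrite coefXn (ltn_eqF (ltn_ord i)) mul0r.
Qed.

Lemma twisted_eval_additive (s : {poly C}) x y : teval s (x + y) = teval s x + teval s y.
Proof.
rewrite /twisted_eval -big_split; apply: eq_bigr => i _ /=.
by rewrite (exprD_cardX s0) mulrDr.
Qed.

Lemma twisted_eval_cst (s : {poly C}) c x : teval s (s0 c * x) = s0 c * teval s x.
Proof.
rewrite /twisted_eval mulr_sumr; apply: eq_bigr => i _.
by rewrite exprMn expr_cardX_cst mulrCA.
Qed.

Lemma twisted_eval_mul (s t : {poly C}) x : teval (tmul s t) x = teval s (teval t x).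
Proof.
rewrite /twisted_mul twisted_eval_sum; apply: eq_bigr => i _.
rewrite twisted_eval_sum.
have -> : teval t x ^+ (q ^ i) = \sum_(j < size t) (t`_j * x ^+ (q ^ j)) ^+ (q ^ i).
  have h0 : (0 : C) ^+ (q ^ i) = 0 by rewrite expr0n expn_eq0 (gtn_eqF q_gt0).
  exact: (big_morph (fun y => y ^+ (q ^ i)) (exprD_cardX s0 i) h0).
rewrite mulr_sumr; apply: eq_bigr => j _.
by rewrite twisted_evalZ twisted_evalXn exprMn -exprM -expnD mulrA addnC.
Qed.

(** The difference acts as the ordinary polynomial with its coefficients moved to the exponents q^i,
    which has too many roots unless it is zero. *)
Lemma twisted_eval_inj (g : nat -> C) (s t : {poly C}) : injective g ->
  (forall n, teval s (g n) = teval t (g n)) -> s = t.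
Proof.
move=> gI h; apply/eqP; rewrite -subr_eq0; apply/eqP; set d := s - t.
have hd n : teval d (g n) = 0.
  by rewrite /d twisted_evalD -scaleN1r twisted_evalZ h mulN1r subrr.
pose p := \sum_(i < size d) d`_i *: 'X^(q ^ i).
have p0 : p = 0.
  apply/eqP; apply: contraT => p0.
  have := max_poly_roots p0 (rs := [seq g i | i <- iota 0 (size p)]).
  rewrite size_map size_iota ltnn map_inj_uniq ?iota_uniq //; apply=> //.
  apply/allP => _ /mapP[n _ ->]; rewrite rootE -[X in _ == X](hd n) /p.
  rewrite /twisted_eval horner_sum; apply/eqP/eq_bigr => i _.
  by rewrite hornerZ hornerXn.
apply/polyP => i; rewrite coef0.
have [hi|hi] := leqP (size d) i; first by rewrite nth_default.
have := congr1 (fun p : {poly C} => p`_(q ^ i)) p0.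
rewrite coef0 /p coef_sum (bigD1 (Ordinal hi)) //= coefZ coefXn eqxx mulr1 big1 ?addr0 //.
move=> j ji; rewrite coefZ coefXn eqn_exp2l ?finNzRing_gt1 // eq_sym.
by move: ji; rewrite -val_eqE /= => /negPf ->; rewrite mulr0.
Qed.

Lemma coef_twisted_mul (s t : {poly C}) k : (tmul s t)`_k =
  \sum_(i < size s | (i <= k)%N) s`_i * t`_(k - i) ^+ (q ^ i).
Proof.
rewrite /twisted_mul coef_sum [RHS]big_mkcond /=; apply: eq_bigr => i _.
rewrite coef_sum; case: leqP => ik; last first.
  rewrite big1 // => j _; rewrite coefZ coefXn ltn_eqF ?mulr0 //.
  exact: leq_trans (leq_addr _ _).
have [hk|hk] := ltnP (k - i) (size t).
  rewrite (bigD1 (Ordinal hk)) //= coefZ coefXn subnKC // eqxx mulr1 big1 ?addr0 //.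
  move=> j jk; rewrite coefZ coefXn; case: eqP => [e|_]; last by rewrite mulr0.
  by case/eqP: jk; apply: val_inj; rewrite /= e addKn.
rewrite [t`_(k - i)]nth_default // expr0n expn_eq0 (gtn_eqF q_gt0) mulr0.
rewrite big1 // => j _; rewrite coefZ coefXn; case: eqP => [e|_]; last by rewrite mulr0.
by move: hk; rewrite e addKn leqNgt ltn_ord.
Qed.

Lemma size_twisted_mul (s t : {poly C}) : s != 0 -> t != 0 ->
  size (tmul s t) = (size s + size t).-1.
Proof.
move=> s0' t0.
have hs : (0 < size s)%N by rewrite size_poly_gt0.
have ht : (0 < size t)%N by rewrite size_poly_gt0.
apply/eqP; rewrite eqn_leq; apply/andP; split.
  apply/leq_sizeP => k hk; rewrite coef_twisted_mul big1 // => i _.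
  rewrite [t`__]nth_default ?expr0n ?expn_eq0 ?(gtn_eqF q_gt0) ?mulr0 //.
  have := ltn_ord i; move: (nat_of_ord i) hs hk; move: (size s) (size t) => m n j; lia.
rewrite leqNgt; apply/negP => hlt.
have : (tmul s t)`_((size s).-1 + (size t).-1) = 0.
  apply: nth_default; move: hs ht hlt; move: (size (tmul s t)) (size s) (size t) => p m n; lia.
have hs1 : ((size s).-1 < size s)%N by rewrite prednK.
rewrite coef_twisted_mul (bigD1 (Ordinal hs1)) /= ?leq_addr // addKn big1 ?addr0.
  move/eqP; rewrite mulf_eq0 expf_eq0 expn_gt0 q_gt0 /=.
  by rewrite -!lead_coefE !lead_coef_eq0 (negPf s0') (negPf t0).
move=> i /andP[_ hi]; rewrite [t`__]nth_default ?expr0n ?expn_eq0 ?(gtn_eqF q_gt0) ?mulr0 //.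
have aux (m n j : nat) : (j < m -> j <> m.-1 -> n <= m.-1 + n.-1 - j)%N by lia.
by apply: aux => //; move: hi; rewrite -val_eqE => /eqP.
Qed.

End TwistedPolynomials.

(** * The rank 2 Drinfeld module generated by a prescribed phi_T *)

Section DrinfeldFromAction.
Variables (F : finFieldType) (C : fieldType) (iota : {rmorphism ratfun F -> C}).
Local Notation q := #|F|.
Local Notation pol := (pol_map iota).
Local Notation cst := (cst_map iota).
Local Notation T := (pol 'X).
Local Notation teval := (twisted_eval F).
Local Notation tmul := (twisted_mul F).
Variable Phi : {poly C}.
Hypothesis Phi0 : Phi`_0 = T.
Hypothesis size_Phi : size Phi = 3%N.
Variable g : nat -> C.
Hypothesis gI : injective g.

Fixpoint twisted_power (n : nat) : {poly C} :=
  if n is m.+1 then tmul Phi (twisted_power m) else 1.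

(** Substitution of Phi for T in a, with powers taken in the twisted ring. *)
Definition action_of (a : {poly F}) : {poly C} :=
  \sum_(i < size a) cst a`_i *: twisted_power i.

Let f x := teval Phi x.

Lemma size_twisted_power n : size (twisted_power n) = (2 * n).+1.
Proof.
elim: n => [|n ih] /=; first by rewrite size_poly1.
rewrite size_twisted_mul ?ih ?size_Phi ?mulnS // -size_poly_gt0 ?ih ?size_Phi //.
Qed.

Lemma coef0_twisted_power n : (twisted_power n)`_0 = T ^+ n.
Proof.
elim: n => [|n ih] /=; first by rewrite coef1.
rewrite coef_twisted_mul size_Phi (bigD1 ord0) //= big1 ?addr0.
  by rewrite Phi0 subn0 ih expr1 exprS.
by move=> i /andP[]; rewrite leqn0 -val_eqE /= => /eqP ->.
Qed.

Lemma twisted_eval_power n x : teval (twisted_power n) x = iter n f x.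
Proof.
elim: n => [|n ih] /=; last by rewrite (twisted_eval_mul cst) ih.
by rewrite -[1]/('X^0) twisted_evalXn expr1.
Qed.

Lemma action_of_widen n (a : {poly F}) : (size a <= n)%N ->
  action_of a = \sum_(i < n) cst a`_i *: twisted_power i.
Proof.
move=> an; rewrite /action_of (big_ord_widen n (fun i => cst a`_i *: twisted_power i)) //.
rewrite big_mkcond /=; apply: eq_bigr => i _.
by case: ltnP => // h; rewrite nth_default ?rmorph0 ?scale0r.
Qed.

Lemma action_ofD a b : action_of (a + b) = action_of a + action_of b.
Proof.
pose n := maxn (size a) (size b).
rewrite (action_of_widen (n := n)) ?size_polyD // (action_of_widen (n := n) (a := a)) ?leq_maxl //.
rewrite (action_of_widen (n := n) (a := b)) ?leq_maxr // -big_split /=.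
by apply: eq_bigr => i _; rewrite -scalerDl coefD; congr (_ *: _); exact: (rmorphD cst).
Qed.

Lemma action_ofC c : action_of c%:P = (cst c)%:P.
Proof.
rewrite (action_of_widen (n := 1)) ?size_polyC ?leq_b1 //.
by rewrite big_ord1 coefC /= -mul_polyC mulr1.
Qed.

Lemma eval_action_of a x : teval (action_of a) x = \sum_(i < size a) cst a`_i * iter i f x.
Proof.
rewrite twisted_eval_sum; apply: eq_bigr => i _.
by rewrite twisted_evalZ twisted_eval_power.
Qed.

Lemma eval_action_ofC c x : teval (action_of c%:P) x = cst c * x.
Proof. by rewrite action_ofC -alg_polyC twisted_evalZ -[1]/('X^0) twisted_evalXn expr1. Qed.

Lemma eval_action_ofMX a x : teval (action_of (a * 'X)) x = teval (action_of a) (f x).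
Proof.
have sz : (size (a * 'X)%R <= (size a).+1)%N.
  by rewrite (leq_trans (size_polyMleq _ _)) // size_polyX addn2.
rewrite (action_of_widen sz) twisted_eval_sum big_ord_recl.
rewrite coefMX rmorph0 scale0r twisted_eval0 add0r eval_action_of.
apply: eq_bigr => i _; rewrite coefMX /= twisted_evalZ.
by rewrite (twisted_eval_mul cst) twisted_eval_power -iterS iterSr.
Qed.

Lemma eval_action_of_comm a x : teval (action_of a) (f x) = f (teval (action_of a) x).
Proof.
rewrite !eval_action_of /f.
rewrite (big_morph (teval Phi) (twisted_eval_additive cst Phi) (_ : teval Phi 0 = 0)).
  by apply: eq_bigr => i _; rewrite (twisted_eval_cst cst) -/(f _) -iterSr.
by rewrite -[0](mul0r 0) -(rmorph0 cst) (twisted_eval_cst cst) rmorph0 !mul0r.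
Qed.

(** Checked on values, where the twisted product is composition; [twisted_eval_inj] carries it back
    to coefficients, so no ring structure on twisted polynomials is needed. *)
Lemma eval_action_ofM a b x :
  teval (action_of (a * b)) x = teval (action_of a) (teval (action_of b) x).
Proof.
elim/poly_ind: a x => [|a c ih] x; first by rewrite mul0r /action_of size_poly0 !big_ord0 !twisted_eval0.
rewrite mulrDl !action_ofD !twisted_evalD; congr (_ + _).
  by rewrite mulrAC !eval_action_ofMX ih eval_action_of_comm.
rewrite eval_action_ofC (eval_action_of b) mulr_sumr mul_polyC.
rewrite (action_of_widen (size_scale_leq c b)) twisted_eval_sum.
apply: eq_bigr => i _; rewrite coefZ rmorphM twisted_evalZ twisted_eval_power.
by rewrite mulrA.
Qed.

Lemma action_of_drinfeld : drinfeld_module iota 2 action_of.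
Proof.
split.
- exact: action_ofD.
- move=> a b; apply: (twisted_eval_inj (F := F) gI) => n.
  by rewrite eval_action_ofM (twisted_eval_mul cst).
- exact: action_ofC.
- move=> a; rewrite pol_mapE /action_of coef_sum -[pol a](congr1 pol (coefK a)) poly_def rmorph_sum.
  apply: eq_bigr => i _; rewrite coefZ coef0_twisted_power -mul_polyC.
  by rewrite rmorphM rmorphXn.
- move=> a a0; rewrite /action_of /deg.
  have [n an] : exists n, size a = n.+1.
    by exists (size a).-1; rewrite prednK // size_poly_gt0.
  have lead0 : cst a`_n != 0.
    have := lead_coef_eq0 a; rewrite lead_coefE an (fmorph_eq0 cst) => ->; exact: a0.
  rewrite an big_ord_recr /= addrC size_polyDl size_scale ?size_twisted_power //.
  rewrite ltnS; apply: leq_trans (size_sum _ _ _) _; apply/bigmax_leqP => i _.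
  apply: leq_trans (size_scale_leq _ _) _; rewrite size_twisted_power.
  by rewrite !mul2n ltn_double.
Qed.

Lemma action_of_X : action_of 'X = Phi.
Proof.
apply: (twisted_eval_inj (F := F) gI) => n.
rewrite -[X in action_of X]mul1r eval_action_ofMX -[1]/(1%:P).
by rewrite eval_action_ofC rmorph1 mul1r.
Qed.

Lemma action_of_attached (e : C -> C) :
  (forall x y, e (x + y) = e x + e y) -> (forall c x, e (cst c * x) = cst c * e x) ->
  (forall x, e (T * x) = f (e x)) ->
  forall a x, e (iota a%:F * x) = teval (action_of a) (e x).
Proof.
move=> eD eZ eT a; elim/poly_ind: a => [|a c ih] x.
  rewrite pol_mapE -(polyC0 F) cst_mapE eZ rmorph0 mul0r.
  by rewrite /action_of size_poly0 big_ord0 twisted_eval0.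
rewrite pol_mapE rmorphD rmorphM mulrDl eD action_ofD twisted_evalD.
by rewrite cst_mapE eZ eval_action_ofC -mulrA -pol_mapE ih eT eval_action_ofMX.
Qed.

End DrinfeldFromAction.

(** * The size of j *)

Section JInvariant.
Variables (F : finFieldType) (R : realType) (C : fieldType).
Variables (iota : {rmorphism ratfun F -> C}) (abs : C -> R).
Hypothesis hv : absolute_value abs.
Hypothesis hn : extends_infty iota abs.
Hypothesis complete : forall u, cauchy_abs abs u -> exists l, cvg_abs abs u l.
Hypothesis hq : odd #|F|.
Local Notation q := #|F|.
Local Notation pol := (pol_map iota).
Local Notation cst := (cst_map iota).
Local Notation T := (pol 'X).
Variable z : C.
Hypothesis z_ge1 : 1 <= abs z.
Hypothesis abs_lat : forall u v,
  abs (pol u * z + pol v) = Num.max (abs (pol u) * abs z) (abs (pol v)).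
Local Notation Lambda := (lattice iota z).
Local Notation e := (lattice_exp abs Lambda).
Local Notation cf := (carlitz_factor F).
Local Notation v1 := (e T^-1).
Local Notation v2 := (cf v1 (e (z / T))).

Let v1_neq0 : v1 != 0.
Proof. exact: (lattice_exp_invT_neq0 hv hn complete z_ge1 abs_lat). Qed.

Let v2_neq0 : v2 != 0.
Proof. exact: (carlitz_factor_neq0 hv hn complete z_ge1 abs_lat). Qed.

Let qS : q = q.-1.+1.
Proof. by rewrite prednK //; exact: ltnW (finNzRing_gt1 F). Qed.

Let q_gt0 : 0 < q%:R :> R. Proof. exact: card_gt0. Qed.

Let abs_v1 : abs v1 = q%:R^-1.
Proof. exact: (abs_lattice_exp_invT hv hn complete z_ge1 abs_lat). Qed.

(* The y of the header; w = y - y^q is as_slope (Artin-Schreier). *)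
Definition slope : C := e (z / T) / v1.
Definition as_slope : C := slope - slope ^+ q.

Lemma as_slopeE : v2 = v1 * as_slope.
Proof.
rewrite /carlitz_factor /as_slope /slope mulrBr mulrCA divff // mulr1; congr (_ - _).
by rewrite expr_div_n {4}qS exprS invfM mulrCA mulVKf.
Qed.

Lemma as_slope_neq0 : as_slope != 0.
Proof. by have := v2_neq0; rewrite as_slopeE mulf_eq0 (negPf v1_neq0). Qed.

Let u1 := (v1 ^+ q.-1)^-1.
Let u2 := (v2 ^+ q.-1)^-1.
(** The expansion of T (1 - u2 tau)(1 - u1 tau), where tau u1 = u1^q tau. *)
Let Phi : {poly C} := T%:P + (- T * (u1 + u2)) *: 'X + (T * (u2 * u1 ^+ q)) *: 'X^2.

Let Phi_coef : [/\ Phi`_0 = T, Phi`_1 = - T * (u1 + u2) & Phi`_2 = T * (u2 * u1 ^+ q)].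
Proof. by rewrite /Phi !coefE /= !mulr0 !mulr1 !addr0 !add0r. Qed.

Let T0 : T != 0 := T_neq0 iota.

Let size_Phi : size Phi = 3%N.
Proof.
have D0 : T * (u2 * u1 ^+ q) != 0.
  by rewrite !mulf_neq0 // ?expf_neq0 ?invr_eq0 ?expf_neq0.
rewrite /Phi addrC size_polyDl size_scale ?size_polyXn //.
rewrite (leq_ltn_trans (size_polyD _ _)) // gtn_max (leq_ltn_trans (size_polyC_leq1 _)) //.
by rewrite (leq_ltn_trans (size_scale_leq _ _)) // size_polyX.
Qed.

Let eval_Phi x : twisted_eval F Phi x = T * cf v2 (cf v1 x).
Proof.
have [h0 h1 h2] := Phi_coef.
rewrite /twisted_eval size_Phi !big_ord_recl big_ord0 /= h0 h1 h2 addr0.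
rewrite expr1 expn1 -mulnn exprM /carlitz_factor -/u1 -/u2 (exprB_card cst) exprMn.
by ring.
Qed.

(** Infinitely many values of e, told apart by their absolute values q^-(n+1); points at which to
    compare twisted polynomials. *)
Let probe (n : nat) : C := e (T ^- n.+1).

Let probe_inj : injective probe.
Proof.
have abs_probe n : abs (probe n) = q%:R ^- n.+1.
  have absE : abs (T ^- n.+1) = q%:R ^- n.+1 by rewrite (absvV hv) (absvX hv) (abs_T hn).
  rewrite /probe (lattice_exp_abs_small hv hn complete z_ge1 abs_lat) // absE.
  by rewrite invf_lt1 ?exprn_gt0 // exprn_egt1 // card_gt1.
move=> m n /(congr1 abs); rewrite !abs_probe => /invr_inj.
by move=> /(ieexprIn q_gt0 (negbT (gt_eqF (card_gt1 F R)))) [].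
Qed.

Let e_mulT x : e (T * x) = twisted_eval F Phi (e x).
Proof. by rewrite eval_Phi (lattice_exp_mulT hv hn complete z_ge1 abs_lat). Qed.

Lemma j_invariantE :
  j_invariant iota abs z =
  T ^+ q * (as_slope ^+ q.-1 + 1) ^+ q.+1 / (as_slope ^+ q.-1) ^+ q.
Proof.
have [h0 h1 h2] := Phi_coef.
have jPhi : (- T * (u1 + u2)) ^+ q.+1 / (T * (u2 * u1 ^+ q)) =
    T ^+ q * (as_slope ^+ q.-1 + 1) ^+ q.+1 / (as_slope ^+ q.-1) ^+ q.
  (* The sign of g disappears because q + 1 is even. *)
  rewrite mulNr -[X in X ^+ _]mulN1r exprMn -signr_odd oddS hq expr0 mul1r.
  have V0 : v1 ^+ q.-1 != 0 by rewrite expf_neq0.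
  have W0 : as_slope ^+ q.-1 != 0 by rewrite expf_neq0 // as_slope_neq0.
  have -> : u2 = (v1 ^+ q.-1 * as_slope ^+ q.-1)^-1 by rewrite -exprMn -as_slopeE.
  rewrite /u1; set V := v1 ^+ _ in V0 *; set W := as_slope ^+ _ in W0 *.
  have -> : V^-1 + (V * W)^-1 = (W + 1) / (V * W) by field; rewrite V0 W0.
  rewrite !exprMn !exprVn exprMn !exprS.
  have Vq : V ^+ q != 0 by rewrite expf_neq0.
  have Wq : W ^+ q != 0 by rewrite expf_neq0.
  by field; rewrite V0 W0 Vq Wq T0.
have phiE phi : attached iota abs Lambda phi -> phi 'X = Phi.
  move=> hphi; apply: (twisted_eval_inj (F := F) probe_inj) => n.
  by rewrite /probe -hphi -e_mulT.
rewrite /j_invariant; case: xgetP => [j _ [phi [_ /phiE hphi ->]]|].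
  by rewrite /drinfeld_j hphi h1 h2 jPhi.
(* An attached module must exist, as otherwise [xget] would return its default. *)
move=> /(_ (T ^+ q * (as_slope ^+ q.-1 + 1) ^+ q.+1 / (as_slope ^+ q.-1) ^+ q)); case.
exists (action_of iota Phi); split.
- exact: (action_of_drinfeld h0 size_Phi probe_inj).
- move=> a x; apply: action_of_attached => //.
  + exact: (lattice_expD hv hn complete z_ge1 abs_lat).
  + exact: (lattice_expZ hv hn complete z_ge1 abs_lat).
- by rewrite /drinfeld_j (action_of_X _ _ probe_inj) h1 h2 jPhi.
Qed.

Lemma abs_j_invariant :
  abs (j_invariant iota abs z) =
  q%:R ^+ q * abs (as_slope ^+ q.-1 + 1) ^+ q.+1 / (abs as_slope ^+ q.-1) ^+ q.
Proof. by rewrite j_invariantE !(absvM hv) (absvV hv) !(absvX hv) (abs_T hn). Qed.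

Section LargeSlope.

Let abs_slope : abs slope = q%:R * abs (e (z / T)).
Proof. by rewrite (absvM hv) (absvV hv) abs_v1 invrK mulrC. Qed.

Lemma abs_carlitz_factor x : 1 < q%:R * abs x ->
  q%:R * abs (cf v1 x) = (q%:R * abs x) ^+ q.
Proof.
move=> x1; have x0 : 0 < abs x.
  by rewrite -(pmulr_rgt0 _ q_gt0); exact: lt_trans ltr01 x1.
have E : abs (x ^+ q / v1 ^+ q.-1) = abs x * (q%:R * abs x) ^+ q.-1.
  rewrite (absvM hv) (absvV hv) !(absvX hv) abs_v1 exprVn invrK {1}qS exprS exprMn.
  by rewrite mulrAC mulrA.
rewrite /carlitz_factor (absvBC hv) (absvB_eq hv) E.
  by rewrite mulrA -exprS -qS.
by rewrite ltr_pMr // exprn_egt1 //; have := finNzRing_gt1 F; case: (q) => [|[]].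
Qed.

(** Here |w| = |y|^q > 1, so the 1 in w^(q-1) + 1 is negligible and one factor |w|^(q-1)
    survives. *)
Lemma abs_j_invariant_large : 1 < q%:R * abs (e (z / T)) ->
  abs (j_invariant iota abs z) =
  q%:R ^+ q * (q%:R * abs (e (z / T))) ^+ (q * q.-1).
Proof.
move=> s1.
have asE : abs as_slope = (q%:R * abs (e (z / T))) ^+ q.
  rewrite -abs_carlitz_factor // as_slopeE (absvM hv) abs_v1 mulVKf //.
  by rewrite gt_eqF.
have W1 : 1 < abs (as_slope ^+ q.-1).
  rewrite (absvX hv) asE -exprM exprn_egt1 //.
  by have := finNzRing_gt1 F; case: (q) => [|[]].
rewrite abs_j_invariant (absvD_eq hv) ?(absv1 hv) // -[abs as_slope ^+ _](absvX hv).
rewrite exprS mulrA mulfK; last by rewrite expf_neq0 // gt_eqF // (lt_trans ltr01).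
by rewrite (absvX hv) asE -exprM.
Qed.

End LargeSlope.

(** T^k l - z is again a lattice vector, so its size is known. Its coordinate T^k u - 1 along z has
    no tie, since for k > 0 the polynomial T^k u is zero or nonconstant. *)
Lemma lattice_factor_abs k l : (0 < k)%N -> Lambda l -> l != 0 ->
  abs (1 - z / T ^+ k / l) = Num.max 1 (abs (z / T ^+ k) / abs l).
Proof.
move=> k0 hl l0; have Tk0 : T ^+ k != 0 by rewrite expf_neq0.
have al0 : 0 < abs l by rewrite (absv_gt0 hv).
have aTk0 : 0 < abs (T ^+ k) by rewrite (absv_gt0 hv).
have lE : abs (T ^+ k * l - z) = Num.max (abs (T ^+ k) * abs l) (abs z).
  case: hl => u [v lE]; rewrite !pol_mapE in lE.
  have -> : T ^+ k * l - z = pol ('X^k * u - 1) * z + pol ('X^k * v).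
    by rewrite lE rmorphB !rmorphM rmorph1 rmorphXn; ring.
  rewrite abs_lat lE abs_lat.
  have -> : abs (pol ('X^k * u - 1)) = Num.max (abs (T ^+ k) * abs (pol u)) 1.
    have [->|u0] := eqVneq u 0.
      rewrite mulr0 rmorphB rmorph0 (absv0 hv) mulr0 sub0r (absvN hv) rmorph1 (absv1 hv).
      by rewrite max_r.
    have h1 : 1 < abs (T ^+ k) * abs (pol u).
      rewrite (absvX hv) (abs_T hn); apply: lt_le_trans (_ : q%:R ^+ k <= _).
        by rewrite exprn_egt1 ?card_gt1 // -lt0n.
      by rewrite ler_peMr ?(abs_pol_ge1 hn u0) // exprn_ge0 // ltW.
    rewrite rmorphB rmorphM rmorph1 rmorphXn (absvB_eq hv) (absvM hv) ?(absv1 hv) //.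
    by rewrite max_l // ltW.
  rewrite rmorphM rmorphXn (absvM hv).
  by rewrite maxr_pMl ?(absv_ge0 hv) // mul1r maxr_pMr ?(absv_ge0 hv) // mulrA maxAC.
have -> : 1 - z / T ^+ k / l = (T ^+ k * l - z) / (T ^+ k * l) by field; rewrite Tk0 l0.
rewrite (absvM hv) lE (absvV hv) (absvM hv) maxr_pMl ?invr_ge0 ?mulr_ge0 ?(absv_ge0 hv) //.
rewrite divff ?mulf_neq0 ?gt_eqF // (absvM hv) (absvV hv); congr (Num.max _ _).
by rewrite invfM mulrA.
Qed.

Let t k := q%:R * abs (e (z / T ^+ k)).

Let z_gt0 : 0 < abs z. Proof. exact: lt_le_trans ltr01 z_ge1. Qed.

(** By [lattice_factor_abs], |e(x)/x| increases with |x| along the points z/T^k. The decrease of t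
    is what makes the second factor harmless in [t_step]. *)
Let t_decr k : (0 < k)%N -> q%:R * t k.+1 <= t k.
Proof.
move=> k0; rewrite ler_pM2l //.
have Tk0 n : 0 < abs (T ^+ n) by rewrite (absv_gt0 hv) expf_neq0.
have aTS : abs (z / T ^+ k) = q%:R * abs (z / T ^+ k.+1).
  have -> : z / T ^+ k.+1 = T^-1 * (z / T ^+ k) by rewrite exprS invfM mulrCA.
  by rewrite [X in _ = _ * X](absvM hv) (absvV hv) (abs_T hn) mulVKf // gt_eqF.
have zk0 : 0 < abs (z / T ^+ k.+1).
  by rewrite (absvM hv) (absvV hv) divr_gt0.
rewrite -(ler_pM2r zk0) -mulrA [abs (e _) * _]mulrC mulrA -aTS mulrC.
apply: (lattice_exp_abs_mono hv hn complete z_ge1 abs_lat) => l hl l0.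
rewrite !lattice_factor_abs // aTS ge_max !le_max lexx /=; apply/orP; right.
rewrite ler_pM2r ?invr_gt0 ?(absv_gt0 hv) // ler_peMl ?(ltW zk0) //.
exact/ltW/card_gt1.
Qed.

Let t_lt_t1 k : 1 < t k.+2 -> t k.+2 < t 1.
Proof.
have tS n : (0 < n)%N -> 0 < t n.+1 -> t n.+1 < t n.
  by move=> n0 tn; apply: lt_le_trans (t_decr n0); rewrite ltr_pMl // card_gt1.
elim: k => [|k ih] t1; first by apply: tS => //; exact: lt_trans t1.
have tk : t k.+3 < t k.+2 by apply: tS => //; exact: lt_trans t1.
exact: lt_trans tk (ih (lt_trans t1 tk)).
Qed.

(** In T psi_2 (psi_1 (e x)) the inner factor raises q|e x| to the power q, while psi_2 preserves
    the size: its argument is smaller than |v2|, because t_(k+1) < t_1. *)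
Let t_step k : (0 < k)%N -> 1 < t k.+1 -> t k = q%:R * t k.+1 ^+ q.
Proof.
case: k => // k _ t1.
have h1 : z / T ^+ k.+1 = T * (z / T ^+ k.+2).
  by rewrite (exprS T k.+1) invfM mulrCA mulVKf.
rewrite {1}/t h1 (lattice_exp_mulT hv hn complete z_ge1 abs_lat) (absvM hv) (abs_T hn).
congr (_ * _); rewrite -abs_carlitz_factor //; congr (_ * _).
set Y := cf v1 (e (z / T ^+ k.+2)); rewrite {1}/carlitz_factor (absvB_eq hv) //.
have t1' := t_lt_t1 t1; rewrite {2}/t expr1 in t1'.
have YT : abs Y < abs v2.
  rewrite -(ltr_pM2l q_gt0) !abs_carlitz_factor //; last exact: lt_trans t1 t1'.
  rewrite ltr_pXn2r ?nnegrE ?mulr_ge0 ?(absv_ge0 hv) ?(ltW q_gt0) //.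
  exact: ltnW (finNzRing_gt1 F).
have Y0 : 0 < abs Y.
  by rewrite -(pmulr_rgt0 _ q_gt0) abs_carlitz_factor // exprn_gt0 // (lt_trans ltr01).
rewrite (absvM hv) (absvV hv) !(absvX hv) ltr_pdivrMr ?exprn_gt0 ?(absv_gt0 hv) //.
rewrite {1}qS exprS ltr_pM2l // ltr_pXn2r ?nnegrE ?(absv_ge0 hv) //.
by have := finNzRing_gt1 F; case: (q) => [|[]].
Qed.

(** The recursion t -> q t^q acts on q^q t^(q(q-1)), the expression for |j|, as the q-th power,
    because q + q(q-1) = q^2. *)
Let chain_step (x : R) : q%:R ^+ q * (q%:R * x ^+ q) ^+ (q * q.-1) =
  (q%:R ^+ q * x ^+ (q * q.-1)) ^+ q :> R.
Proof.
rewrite !exprMn mulrA -exprD -!exprM; congr (_ ^+ _ * _ ^+ _); last by rewrite mulnAC mulnA.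
by rewrite -mulnS -qS.
Qed.

Lemma abs_j_invariant_gt1 k : q%:R ^+ k < abs z <= q%:R ^+ k.+1 ->
  abs (j_invariant iota abs z) =
  (q%:R ^+ q * (abs z / q%:R ^+ k) ^+ (q * q.-1)) ^+ (q ^ k).
Proof.
move=> /andP[zk zk1].
have qk0 n : 0 < q%:R ^+ n :> R by rewrite exprn_gt0.
have abs_zT n : abs (z / T ^+ n) = abs z / q%:R ^+ n.
  by rewrite (absvM hv) (absvV hv) (absvX hv) (abs_T hn).
have tk : t k.+1 = abs z / q%:R ^+ k.
  (* At index k+1 the point z/T^(k+1) has size at most 1, so each factor of the product has size 1
     and e preserves its size. *)
  rewrite /t (lattice_exp_abs_id hv hn complete z_ge1 abs_lat) => [|l hl l0].
    by rewrite abs_zT exprS invfM mulrCA mulVKf // gt_eqF.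
  rewrite lattice_factor_abs // max_l // abs_zT.
  have l1 := lattice_abs_ge1 hn z_ge1 abs_lat hl l0.
  rewrite ler_pdivrMr ?(lt_le_trans ltr01 l1) // mul1r; apply: le_trans l1.
  by rewrite ler_pdivrMr // mul1r.
have tk1 : 1 < t k.+1 by rewrite tk ltr_pdivlMr // mul1r.
rewrite -tk => {zk zk1 tk}.
suff [h1 ->] : 1 < t 1 /\ (q%:R ^+ q * t k.+1 ^+ (q * q.-1)) ^+ (q ^ k) =
    q%:R ^+ q * t 1 ^+ (q * q.-1).
  by rewrite abs_j_invariant_large; move: h1; rewrite /t expr1.
elim: k tk1 => [|k ih] tk1; first by rewrite expr1.
have tE := t_step (ltn0Sn k) tk1.
have tk : 1 < t k.+1.
  rewrite tE (lt_trans (card_gt1 F R)) // ltr_pMr // exprn_egt1 //.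
  by rewrite -lt0n qS.
have [h1 h2] := ih tk; split=> //.
by rewrite -h2 tE chain_step expnS exprM.
Qed.

(** * The bound on j when |z| = 1 *)

Section UnitNorm.
Hypothesis z1 : abs z = 1.
Variable e0 : F.
Hypothesis z_sqr : abs (z ^+ 2 + cst e0) <= q%:R^-1.

Let q_inv_lt1 : q%:R^-1 < 1 :> R.
Proof. by rewrite invf_lt1 // card_gt1. Qed.

Let e0_neq0 : e0 != 0.
Proof.
apply/eqP => e00; move: z_sqr.
by rewrite e00 rmorph0 addr0 (absvX hv) z1 expr1n leNgt q_inv_lt1.
Qed.

Let z_frobenius : abs (z ^+ (q ^ 2) - z) <= q%:R^-1.
Proof.
have qP : odd q.-1 = false by move: hq; rewrite {1}qS /= => /negbTE.
(* As q is odd, q^2 - 1 = 2 m, so z^(q^2-1) = (z^2)^m is close to (-e0)^m = (-e0)^(q-1) = 1. *)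
pose m := (q.-1./2 * q.+1)%N.
have mE : (q ^ 2 = (2 * m).+1)%N.
  rewrite /m mulnA mul2n halfK.
  rewrite qP subn0 -mulnn; move: (finNzRing_gt1 F); nia.
have -> : z ^+ (q ^ 2) - z = z * ((z ^+ 2) ^+ m - (- cst e0) ^+ m).
  have -> : (- cst e0) ^+ m = 1.
    rewrite -rmorphN -rmorphXn -[RHS](rmorph1 cst); congr (cst _).
    have x0 : - e0 != 0 by rewrite oppr_eq0.
    rewrite /m mulnS mulnC exprD exprM expf_card -exprD addnn halfK qP subn0.
    by apply: (mulfI x0); rewrite -exprS -qS expf_card mulr1.
  by rewrite mE exprS exprM mulrBr mulr1.
rewrite (absvM hv) z1 mul1r; apply: (absv_exprB hv); rewrite ?opprK //.
  by rewrite (absvX hv) z1 expr1n.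
by rewrite (absvN hv) (abs_cst_le1 hv hn).
Qed.

Let abs_invT : abs T^-1 = q%:R^-1. Proof. by rewrite (absvV hv) (abs_T hn). Qed.

(** e moves z/T and 1/T by at most 1/q^2; dividing by [v1], of size 1/q, loses one factor q. *)
Let slope_near : abs (slope - z) <= q%:R^-1.
Proof.
have -> : slope - z = ((e (z / T) - z / T) - z * (e T^-1 - T^-1)) / v1.
  by rewrite /slope; field; rewrite v1_neq0 T0.
have small x : abs x = q%:R^-1 -> abs (e x - x) <= q%:R^-1 * q%:R^-1.
  move=> ax; rewrite -{1}ax -{1}ax.
  by apply: (lattice_exp_near hv hn complete z_ge1 abs_lat); rewrite ax ltW.
rewrite (absvM hv) (absvV hv) abs_v1 ler_pdivrMr ?invr_gt0 //.
apply: (absvB_le hv); first by apply: small; rewrite (absvM hv) z1 mul1r.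
by rewrite (absvM hv) z1 mul1r small.
Qed.

(** Absence of cancellation gives |z - d| = 1, and y is closer to z than that. Hence w, up to sign
    the product of all y - d, has size 1. *)
Let abs_slope_cst d : abs (slope - cst d) = 1.
Proof.
have zc : abs (z - cst d) = 1.
  have -> : z - cst d = pol 1 * z + pol (- d%:P).
    by rewrite rmorph1 mul1r rmorphN.
  rewrite abs_lat rmorph1 (absv1 hv) mul1r z1 rmorphN (absvN hv) max_l //.
  exact: abs_cst_le1.
rewrite -[RHS]zc; apply: (absv_near hv); rewrite zc.
have -> : slope - cst d - (z - cst d) = slope - z by ring.
exact: le_lt_trans slope_near q_inv_lt1.
Qed.

Let abs_as_slope : abs as_slope = 1.
Proof.
rewrite /as_slope (absvBC hv) -(prod_sub_cst cst) (absv_prod hv) big1 //.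
Qed.

Lemma abs_j_invariant_unit : abs (j_invariant iota abs z) <= q%:R^-1.
Proof.
have slope1 : abs slope = 1 by rewrite -[slope]subr0 -(rmorph0 cst) abs_slope_cst.
rewrite abs_j_invariant abs_as_slope !expr1n divr1.
have h : abs (as_slope ^+ q.-1 + 1) <= q%:R^-1.
  rewrite -[leLHS]mul1r -{1}abs_as_slope -(absvM hv) mulrDr mulr1 -exprS -qS.
  rewrite /as_slope (exprB_card cst) -exprM.
  (* w^q + w telescopes to y - y^(q^2), which is compared with z - z^(q^2). *)
  have -> : slope ^+ q - slope ^+ (q * q) + (slope - slope ^+ q) =
      (slope - z) - (z ^+ (q ^ 2) - z) - (slope ^+ (q ^ 2) - z ^+ (q ^ 2)).
    by rewrite -mulnn; ring.
  apply: (absvB_le hv); first exact: (absvB_le hv).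
  by apply: (absv_exprB hv); rewrite ?slope1 ?z1.
apply: (@le_trans _ _ (q%:R ^+ q * q%:R^-1 ^+ q.+1)).
  by rewrite ler_wpM2l ?exprn_ge0 ?(ltW q_gt0) // lerXn2r ?nnegrE ?invr_ge0 ?(absv_ge0 hv) ?(ltW q_gt0).
by rewrite exprS mulrCA -exprMn divff ?gt_eqF // expr1n mulr1.
Qed.

End UnitNorm.

End JInvariant.

(** * Degrees and residues read off the defining equation *)

Section FundamentalDegrees.
Variables (F : finFieldType) (R : realType) (C : fieldType).
Variables (iota : {rmorphism ratfun F -> C}) (abs : C -> R).
Hypothesis hv : absolute_value abs.
Hypothesis hn : extends_infty iota abs.
Hypothesis hq : odd #|F|.
Variables (a b c : {poly F}) (z : C).
Hypothesis hz : defining_equation iota abs a b c z.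
Local Notation q := #|F|.
Local Notation pol := (pol_map iota).
Local Notation cst := (cst_map iota).

Let a_neq0 : a != 0. Proof. by case: hz => _ /monic_neq0. Qed.

Let c_neq0 : c != 0.
Proof.
case: hz => _ _ _; rewrite !pol_mapE => ac _; rewrite -(pol_eq0 iota) -(absv_gt0 hv).
by apply: lt_le_trans ac; rewrite (absv_gt0 hv) pol_eq0.
Qed.

Let q_gt0 : 0 < q%:R :> R := card_gt0 F R.

Lemma fundamental_abs_deg : (deg a <= deg c)%N /\ abs z ^+ 2 = q%:R ^+ (deg c - deg a).
Proof.
have ac : (deg a <= deg c)%N.
  case: hz => _ _ _; rewrite !pol_mapE (abs_pol_le hv hn) => h _.
  by rewrite /deg -!subn1 leq_sub2r.
split=> //.
have a0 : q%:R ^+ deg a != 0 :> R by rewrite expf_neq0 // gt_eqF.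
apply: (mulfI a0); rewrite -exprD subnKC //.
by have := fundamental_abs_sqr hv hz; rewrite !(abs_pol hn).
Qed.

(** Since |b| < |a| <= |c| and 4 is a unit of F, the term 4 a c dominates b^2. *)
Lemma fundamental_disc_deg : deg (b ^+ 2 - 4%:R * a * c) = (deg a + deg c)%N.
Proof.
have a0 : 0 < abs (pol a) by rewrite (absv_gt0 hv) pol_eq0.
have dE : abs (pol (b ^+ 2 - 4%:R * a * c)) = abs (pol a) * abs (pol c).
  have h4 : abs (pol (4%:R * a * c)) = abs (pol a) * abs (pol c).
    rewrite !rmorphM rmorph_nat -mulrA (natrM C 2 2) -mulrA !(abs_mul2 hv hn hq).
    exact: (absvM hv).
  rewrite rmorphB (absvBC hv) (absvB_eq hv) // h4 rmorphXn (absvX hv) expr2.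
  case: hz; rewrite !pol_mapE => _ _ ba ac _.
  by apply: ltr_pM; rewrite ?(absv_ge0 hv) //; exact: lt_le_trans ac.
have d0 : b ^+ 2 - 4%:R * a * c != 0.
  by rewrite -(pol_eq0 iota) -(absv_gt0 hv) dE mulr_gt0 // (absv_gt0 hv) pol_eq0.
move: dE; rewrite !(abs_pol hn) // -exprD.
by move=> /(ieexprIn q_gt0 (negbT (gt_eqF (card_gt1 F R)))).
Qed.

(** The constant is the leading digit of c/a, which has size 1; b/a and the rest of c/a lie in k and
    are smaller than 1, hence at most 1/q. *)
Lemma fundamental_unit_residue : abs z = 1 ->
  exists e, abs (z ^+ 2 + cst e) <= q%:R^-1.
Proof.
move=> z1; case: hz; rewrite !pol_mapE => eqz _ ba _ _.
have a0 : 0 < abs (pol a) by rewrite (absv_gt0 hv) pol_eq0.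
have rat1 : rational iota 1 by rewrite -(rmorph1 pol); exact: rational_pol.
have rat_div p : rational iota (pol p / pol a).
  by apply: rationalM; [|apply: rationalV]; exact: rational_pol.
have [|e he] := rational_digit hv hn (rat_div c) rat1 (oner_neq0 _).
  rewrite (absvM hv) (absvV hv) ler_pdivrMr // (absv1 hv) mul1r.
  by rewrite -(fundamental_abs_sqr hv hz) z1 expr1n mulr1.
exists e.
have -> : z ^+ 2 + cst e = - (pol b / pol a * z) - (pol c / pol a - cst e * 1).
  have pa0 : pol a != 0 by rewrite pol_eq0.
  by apply: (mulfI pa0); apply/eqP; rewrite -subr_eq0 -eqz; apply/eqP; field.
have -> : q%:R^-1 = abs 1 / q%:R by rewrite (absv1 hv) mul1r.
apply: (absvB_le hv).
  rewrite (absvN hv) (absvM hv) z1 mulr1; apply: (rational_discrete hv hn) => //.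
  by rewrite (absv1 hv) (absvM hv) (absvV hv) ltr_pdivrMr // mul1r.
apply: (rational_discrete hv hn) => //; rewrite mulr1 -[- _]mulN1r.
apply: rationalD => //; apply: rationalM; last exact: rational_cst.
by rewrite -(rmorphN1 pol); exact: rational_pol.
Qed.

End FundamentalDegrees.

Lemma Bconst_even (R : realType) (q k : nat) : (0 < q)%N ->
  (q%:R ^+ q * (q%:R ^+ k.+1 / q%:R ^+ k) ^+ (q * q.-1)) ^+ (q ^ k) =
  (q%:R ^+ q) `^ (q%:R ^+ k.+1) :> R.
Proof.
move=> q0; have qk0 : q%:R ^+ k != 0 :> R by rewrite expf_neq0 // pnatr_eq0 -lt0n.
rewrite -{2}[q%:R ^+ k.+1]natrX powR_mulrn ?exprn_ge0 // exprS mulfK // -exprD.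
by rewrite -!exprM -mulnS prednK // -mulnA -expnS.
Qed.

Lemma Bconst_odd (R : realType) (q k : nat) : (0 < q)%N ->
  let s : R := Num.sqrt q%:R in
  (q%:R ^+ q * (s * q%:R ^+ k / q%:R ^+ k) ^+ (q * q.-1)) ^+ (q ^ k) =
  (q%:R `^ (s * (q%:R + 1) / 2)) `^ (s * q%:R ^+ k).
Proof.
move=> q0 s; have qk0 : q%:R ^+ k != 0 :> R by rewrite expf_neq0 // pnatr_eq0 -lt0n.
have s2 : s ^+ 2 = q%:R by rewrite sqr_sqrtr.
have s0 : 0 <= s by rewrite sqrtr_ge0.
rewrite mulfK // -powRrM.
(* The two square roots multiply to q, leaving half of a natural exponent; that half is absorbed by
   writing q = s^2. *)
have -> : s * (q%:R + 1) / 2 * (s * q%:R ^+ k) =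
    2^-1 * (q * q.+1 * q ^ k)%N%:R.
  by rewrite !natrM natrX -[q.+1]addn1 natrD -s2; field.
rewrite powRrM -[(_ `^ 2^-1)]/(_) powR_mulrn ?powR_ge0 // powR12_sqrt // -/s.
rewrite -{1}s2 -!exprM -exprD -exprM; congr (_ ^+ (_ * _)).
by rewrite -{3 4}(prednK q0); lia.
Qed.

Theorem theorem3p5 (F : finFieldType) (R : realType) (C : fieldType)
    (iota : {rmorphism ratfun F -> C}) (abs : C -> R)
    (hC : is_Cinfty iota abs) (hq : odd #|F|)
    (K : fieldExtType (ratfun F)) (hK : imaginary_quadratic R K)
    (emb : {rmorphism K -> C}) (hemb : forall x : ratfun F, emb x%:A = iota x)
    (a b c d : {poly F}) (sqrtd z : C)
    (hd : d = b ^+ 2 - 4%:R * a * c) (hsqrtd : sqrtd ^+ 2 = iota d%:F)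
    (hz : z = (- iota b%:F + sqrtd) / (2%:R * iota a%:F))
    (habc : defining_equation iota abs a b c z)
    (hDK : (quad_fund_domain iota abs `&` range emb) z) :
  (abs z = 1 -> abs (j_invariant iota abs z) <= (#|F|%:R)^-1) /\
  (1 < abs z ->
     abs (j_invariant iota abs z) = Bconst R #|F| (deg d) `^ abs z).
Proof.
have hv := Cinfty_absv hC; have hn := Cinfty_normalized hC.
have complete := Cinfty_complete hC.
have [[zO _] _] := hDK.
have z_ge1 := fundamental_abs_ge1 hv habc.
have abs_lat := abs_lattice hv hn hq habc zO.
have q0 : (0 < #|F|)%N by exact: ltnW (finNzRing_gt1 F).
have qR0 : 0 < #|F|%:R :> R := card_gt0 F R.
split=> [z1|z_gt1].
  have [e he] := fundamental_unit_residue hv hn habc z1.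
  exact: (abs_j_invariant_unit hv hn complete hq z_ge1 abs_lat z1 he).
have [ac zE] := fundamental_abs_deg hv hn habc.
(* The sum deg a + deg c and the difference deg c - deg a have the same parity, and |z|^2 is q to
   the latter. *)
have dE : odd (deg d) = odd (deg c - deg a).
  by rewrite hd (fundamental_disc_deg hv hn hq habc) oddB // oddD addbC.
rewrite /Bconst dE; set D := (deg c - deg a)%N in zE *.
have D0 : (0 < D)%N.
  rewrite lt0n; apply/eqP => D0; have : 1 < abs z ^+ 2 by rewrite exprn_egt1.
  by rewrite zE D0 ltxx.
have abs_ge0 := absv_ge0 hv z.
have [Dodd|Deven] := boolP (odd D).
  have [k Dk] : exists k, D = k.*2.+1.
    by exists D./2; rewrite -{1}[D]odd_double_half Dodd.
  have zs : abs z = Num.sqrt #|F|%:R * #|F|%:R ^+ k.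
    apply/eqP; rewrite -(eqrXn2 (n := 2)) ?mulr_ge0 ?sqrtr_ge0 ?exprn_ge0 ?(ltW qR0) //.
    by rewrite zE Dk exprMn sqr_sqrtr ?(ltW qR0) // -exprM muln2 exprS.
  rewrite (abs_j_invariant_gt1 hv hn complete hq z_ge1 abs_lat (k := k)).
    by rewrite zs Bconst_odd.
  have s1 : 1 < Num.sqrt #|F|%:R :> R by rewrite -[ltLHS]sqrtr1 ltr_sqrt // card_gt1.
  rewrite zs ltr_pMl ?exprn_gt0 // s1 exprS ler_pM2r ?exprn_gt0 //=.
  rewrite -[leRHS](sqr_sqrtr (ltW qR0)) expr2 ler_peMl ?sqrtr_ge0 //; exact: ltW.
(* With |z| = q^(k+1) the upper bound in [abs_j_invariant_gt1] is attained, so the index is one less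
   than half of [D]. *)
have [k Dk] : exists k, D = k.+1.*2.
  exists D./2.-1; rewrite prednK; first by rewrite -{1}[D]odd_double_half (negPf Deven).
  by move: D0 Deven; case: (D) => [|[|]].
have zs : abs z = #|F|%:R ^+ k.+1.
  apply/eqP; rewrite -(eqrXn2 (n := 2)) ?exprn_ge0 ?(ltW qR0) //.
  by rewrite zE Dk -exprM muln2.
rewrite (abs_j_invariant_gt1 hv hn complete hq z_ge1 abs_lat (k := k)).
  by rewrite zs Bconst_even.
by rewrite zs lexx andbT ltr_eXn2l // card_gt1.
Qed.
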